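(* For each point $P_i\in C_0\cap\bigcup_{j\ge1}C_j$, $$(f_1,f_2,f_3)^{x_0}_{C_0,P_i}=\exp\left((2\pi i)^{-2}\,\mathrm{Log}(f_1,f_2,f_3)^{x_0,\gamma_i}_{C_0,P_i}\right)g_1(Q)^{m_2n_3}g_3(Q)^{-m_2n_1},$$ where $Q$ is the base point.
   Context: Let $X$ be a smooth complex projective surface and let $f_1,f_2,f_3$ be non-zero rational functions on $X$. Let $C_0,\dots,C_r$ be the irreducible components of the divisors of $f_1,f_2,f_3$. Assume that every $C_i$ is non-singular and that the components have normal crossings (at an intersection point only two components meet, and they meet transversally). Put $n_{ki}=\mathrm{ord}_{C_i}f_k$ and $m_k=n_{k0}$. For each $i$ let $x_i$ be a rational function on $X$ with $\mathrm{ord}_{C_j}x_i=\delta_{ij}$ for all $j$ ($x_i$ may have other zeros and poles); the same $x_0$ is used at all points of $C_0$. Let $\{P_1,\dots,P_s\}=C_0\cap\bigcup_{j\ge1}C_j$. At $P_i\in C_0\cap C_j$ put $n_k=n_{kj}$ and define $g_k$ by $f_k=x_0^{m_k}x_j^{n_k}g_k$; $x_0,x_j$ define $C_0,C_j$ near $P_i$, so $g_k$ is well defined and non-zero at $P_i$. Refined Parshin symbol: $(f_1,f_2,f_3)^{x_0}_{C_0,P_i}=(-1)^{n_1n_3m_2-m_1m_3n_2}\left(\dfrac{g_1(P_i)^{n_3}}{g_3(P_i)^{n_1}}\right)^{m_2}$. Let $g$ be the genus of $C_0$ and $Q\in C_0$ a base point different from all $P_i$. Let $R_i\in C_0$ be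 a point in an $\epsilon$-neighbourhood of $P_i$, $\gamma_i$ a path on $C_0$ from $Q$ to $R_i$, $\sigma_i^0$ a small simple loop around $P_i$ based at $R_i$, and $\sigma_i=\gamma_i\sigma_i^0\gamma_i^{-1}$. Let $\alpha_j,\beta_j$ ($1\le j\le g$) be loops around the handles of $C_0$ based at $Q$; the paths are chosen so that $\prod_{j=1}^g[\alpha_j,\beta_j]\prod_{i=1}^s\sigma_i$ is homotopic to the trivial loop at $Q$ in $C_0\setminus\{P_1,\dots,P_s\}$. The point $Q$ and the paths avoid the zeros and poles of the functions being integrated; $dg_k/g_k$ is restricted to $C_0$. Logarithm of the refined symbol: $$\mathrm{Log}(f_1,f_2,f_3)^{x_0,\gamma_i}_{C_0,P_i}=(2\pi i)^2\left(\pi i(m_2n_1n_3-n_2m_1m_3)+m_2n_3\int_{\gamma_i}\frac{dg_1}{g_1}-m_2n_1\int_{\gamma_i}\frac{dg_3}{g_3}\right),$$ with the integrals understood in the limit $\epsilon\to0$, i.e. with $R_i\to P_i$. (In $\pi i$, $2\pi i$ the letter $i$ is the imaginary unit.) *)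

(* Defs.v *)
From HB Require Import structures.
From mathcomp Require Import all_boot all_order all_algebra.
(* the notations of mpoly clash with those of mathcomp-analysis *)
From mathcomp Require Import -(notations) mpoly.
From mathcomp Require Import all_classical all_reals all_analysis.
From mathcomp Require Import complex.
Set Implicit Arguments.
Unset Strict Implicit.
Unset Printing Implicit Defensive.
Import Order.TTheory GRing.Theory Num.Theory numFieldNormedType.Exports.
Local Open Scope classical_set_scope.
Local Open Scope ring_scope.

(** * Classical projective varieties

  A point of P^N is given by a nonzero row vector of homogeneous coordinates,
  and [(u == v)%MS] (equality of row spaces) says that two nonzero vectors
  give the same point.  A subset of P^N is given by the set of all the
  coordinate vectors of its points. *)

Section Varieties.
Variables (K : fieldType) (N : nat).

Definition hpoly := mpoly.mpoly N.+1 K.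

Definition hev (F : hpoly) (v : 'rV[K]_N.+1) : K := mpoly.meval (v ord0) F.

Definition homog (d : nat) (F : hpoly) : Prop :=
  F \is mpoly.ishomog1 d mpoly.mdeg.

Definition ppoint (P : 'rV[K]_N.+1) : set 'rV[K]_N.+1 :=
  [set v | v != 0 /\ (v == P)%MS].

Definition vanishes (F : hpoly) (Z : set 'rV[K]_N.+1) : Prop :=
  forall v, Z v -> hev F v = 0.

Definition proj_zeros (S : set hpoly) : set 'rV[K]_N.+1 :=
  [set v | v != 0 /\ forall F, S F -> hev F v = 0].

Definition proj_closed (Z : set 'rV[K]_N.+1) : Prop :=
  exists2 S : set hpoly,
    (forall F, S F -> exists d, homog d F) & Z = proj_zeros S.

Definition variety (Z : set 'rV[K]_N.+1) : Prop :=
  [/\ proj_closed Z, Z !=set0 &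
      forall A B, proj_closed A -> proj_closed B ->
        Z `<=` A `|` B -> Z `<=` A \/ Z `<=` B].

Definition has_chain (Z : set 'rV[K]_N.+1) (d : nat) : Prop :=
  exists W : nat -> set 'rV[K]_N.+1,
    (forall i, (i <= d)%N -> variety (W i) /\ W i `<=` Z) /\
    (forall i, (i < d)%N -> W i `<=` W i.+1 /\ W i <> W i.+1).

Definition has_dim (Z : set 'rV[K]_N.+1) (d : nat) : Prop :=
  has_chain Z d /\ ~ has_chain Z d.+1.

(* the tangent space at P of the affine cone over Z; its dimension is one more
   than that of the tangent space of Z at the point P *)
Definition cone_tangent (Z : set 'rV[K]_N.+1) (P : 'rV[K]_N.+1) :
    set 'rV[K]_N.+1 :=
  [set w | forall d F, homog d F -> vanishes F Z ->
     \sum_(i < N.+1) hev (mpoly.mderiv i F) P * w ord0 i = 0].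

Definition nonsingular_at (Z : set 'rV[K]_N.+1) (P : 'rV[K]_N.+1) : Prop :=
  exists d, has_dim Z d /\
    exists B : 'M[K]_(d.+1, N.+1),
      row_free B /\ forall w, cone_tangent Z P w <-> (w <= B)%MS.

Definition smooth (Z : set 'rV[K]_N.+1) : Prop :=
  forall P, Z P -> nonsingular_at Z P.

Definition transverse_at (X Y Y' : set 'rV[K]_N.+1) (P : 'rV[K]_N.+1) : Prop :=
  forall w, cone_tangent X P w ->
    exists u u', [/\ cone_tangent Y P u, cone_tangent Y' P u' & w = u + u'].

(** ** Rational functions

  A rational function on a variety Z is a fraction [f.1 / f.2] of homogeneous
  polynomials of the same degree whose denominator does not vanish identically
  on Z, up to the equivalence [rf_eq Z]. *)

Definition rfrac : Type := hpoly * hpoly.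

Definition ratfun (Z : set 'rV[K]_N.+1) (f : rfrac) : Prop :=
  (exists d, homog d f.1 /\ homog d f.2) /\ ~ vanishes f.2 Z.

Definition rf_eq (Z : set 'rV[K]_N.+1) (f g : rfrac) : Prop :=
  vanishes (f.1 * g.2 - g.1 * f.2) Z.

Definition rf_const (a : K) : rfrac := (mpoly.mpolyC N.+1 a, 1).
Definition rf_add (f g : rfrac) : rfrac := (f.1 * g.2 + g.1 * f.2, f.2 * g.2).
Definition rf_mul (f g : rfrac) : rfrac := (f.1 * g.1, f.2 * g.2).
Definition rf_inv (f : rfrac) : rfrac := (f.2, f.1).
Definition rf_pow (f : rfrac) (n : int) : rfrac :=
  match n with
  | Posz k => (f.1 ^+ k, f.2 ^+ k)
  | Negz k => (f.2 ^+ k.+1, f.1 ^+ k.+1)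
  end.

(** ** Local rings

  For a subvariety W of Z, let O_W be the local ring of Z along W.
  [germ Z W f h]: the fraction h represents f, and shows that f is in O_W. *)

Definition germ (Z W : set 'rV[K]_N.+1) (f h : rfrac) : Prop :=
  [/\ ratfun Z f, ratfun Z h, rf_eq Z f h & ~ vanishes h.2 W].

Definition regular_along (Z W : set 'rV[K]_N.+1) (f : rfrac) : Prop :=
  exists h, germ Z W f h.

Definition unit_along (Z W : set 'rV[K]_N.+1) (f : rfrac) : Prop :=
  exists2 h, germ Z W f h & ~ vanishes h.1 W.

Definition in_ideal (Z W Y : set 'rV[K]_N.+1) (f : rfrac) : Prop :=
  exists2 h, germ Z W f h & vanishes h.1 Y.

(* t generates the ideal of Y in O_W; if W is not contained in Y, this ideal
   is the whole ring and t is a unit *)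
Definition local_equation (Z W Y : set 'rV[K]_N.+1) (t : rfrac) : Prop :=
  in_ideal Z W Y t /\
  forall f, in_ideal Z W Y f ->
    exists2 u, regular_along Z W u & rf_eq Z f (rf_mul t u).

(* the discrete valuation of O_Y, for Y of codimension one:
   f = t ^ n * u with t a uniformizer and u a unit *)
Definition ord_along (Z Y : set 'rV[K]_N.+1) (f : rfrac) (n : int) : Prop :=
  ratfun Z f /\
  exists t u, [/\ local_equation Z Y Y t, unit_along Z Y u &
                  rf_eq Z f (rf_mul (rf_pow t n) u)].

Definition rf_val (Z : set 'rV[K]_N.+1) (f : rfrac) (P : 'rV[K]_N.+1) : K :=
  xget 0 [set a | exists2 h, germ Z (ppoint P) f h & a = hev h.1 P / hev h.2 P].

Definition rf_restrict (Z Y : set 'rV[K]_N.+1) (f : rfrac) : rfrac :=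
  xget ((0 : hpoly), (1 : hpoly)) [set h : hpoly * hpoly | germ Z Y f h].

Definition prime_divisor (X Y : set 'rV[K]_N.+1) : Prop :=
  [/\ variety Y, Y `<=` X & exists d, has_dim Y d /\ has_dim X d.+1].

(* div f = \sum_i n_i C_i: near every point, f is a unit times the product of
   the powers t_i ^ n_i of local equations t_i of the C_i *)
Definition has_divisor (X : set 'rV[K]_N.+1) (f : rfrac) (r : nat)
    (C : 'I_r -> set 'rV[K]_N.+1) (n : 'I_r -> int) : Prop :=
  forall P, X P -> exists (t : 'I_r -> rfrac) u,
    [/\ forall i, local_equation X (ppoint P) (C i) (t i),
        unit_along X (ppoint P) u &
        rf_eq X f (rf_mul u (\big[rf_mul/rf_const 1]_(i < r)
                                rf_pow (t i) (n i)))].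

(** ** Genus of a smooth curve: g is the maximum of deg D + 1 - l(D) over all
  divisors D (Riemann's theorem) *)

Definition divisor : Type := seq ('rV[K]_N.+1 * int).

Definition div_on (C : set 'rV[K]_N.+1) (D : divisor) : Prop :=
  forall x, x \in D -> C x.1.

Definition div_deg (D : divisor) : int := \sum_(x <- D) x.2.

Definition div_mult (D : divisor) (P : 'rV[K]_N.+1) : int :=
  \sum_(x <- D | (x.1 == P)%MS) x.2.

Definition in_RR_space (C : set 'rV[K]_N.+1) (D : divisor) (f : rfrac) : Prop :=
  ratfun C f /\
  (vanishes f.1 C \/
   forall P, C P ->
     exists2 n, ord_along C (ppoint P) f n & - div_mult D P <= n).

Definition rf_lincomb d (b : 'I_d -> rfrac) (a : 'I_d -> K) : rfrac :=
  \big[rf_add/rf_const 0]_(i < d) rf_mul (rf_const (a i)) (b i).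

Definition RR_dim (C : set 'rV[K]_N.+1) (D : divisor) (d : nat) : Prop :=
  exists b : 'I_d -> rfrac,
    [/\ forall i, in_RR_space C D (b i),
        forall a, vanishes (rf_lincomb b a).1 C -> forall i, a i = 0 &
        forall f, in_RR_space C D f -> exists a, rf_eq C f (rf_lincomb b a)].

Definition has_genus (C : set 'rV[K]_N.+1) (g : nat) : Prop :=
  (forall D d, div_on C D -> RR_dim C D d ->
     div_deg D + 1 - d%:Z <= g%:Z) /\
  (exists D d, [/\ div_on C D, RR_dim C D d & div_deg D + 1 - d%:Z = g%:Z]).

End Varieties.

Section ComplexCalculus.
Variable R : realType.

Definition cexp (z : R[i]) : R[i] :=
  real_complex R (expR (complex.Re z)) *
  Complex (cos (complex.Im z)) (sin (complex.Im z)).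

Definition ipi : R[i] := Complex 0 (pi : R).

Definition cderive (phi : R -> R[i]) (t : R) : R[i] :=
  Complex (derive1 (@complex.Re R \o phi) t) (derive1 (@complex.Im R \o phi) t).

Definition cintegral (a b : R) (phi : R -> R[i]) : R[i] :=
  Complex (\int[lebesgue_measure]_(t in `[a, b]) complex.Re (phi t))
          (\int[lebesgue_measure]_(t in `[a, b]) complex.Im (phi t)).

Definition dlog_integral (a b : R) (phi : R -> R[i]) : R[i] :=
  cintegral a b (fun t => cderive phi t / phi t).

Definition clim_left (a : R) (phi : R -> R[i]) : R[i] :=
  Complex (lim (complex.Re (phi t) @[t --> a^'-]))
          (lim (complex.Im (phi t) @[t --> a^'-])).

Definition C1_on (a b : R) (phi : R -> R) : Prop :=
  exists psi : R -> R,
    [/\ forall t, derivable psi t 1, continuous (derive1 psi) &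
        forall t, a <= t <= b -> phi t = psi t].

Definition piecewise_C1 (a b : R) (N : nat) (l : R -> 'rV[R[i]]_N.+1) : Prop :=
  exists s : seq R,
    [/\ path <%R a s, last a s = b &
        forall j k, (j < size s)%N ->
          C1_on (nth a (a :: s) j) (nth a s j)
                (fun t => complex.Re (l t ord0 k)) /\
          C1_on (nth a (a :: s) j) (nth a s j)
                (fun t => complex.Im (l t ord0 k))].

Definition coord_continuous (T : topologicalType) (N : nat) (A : set T)
    (l : T -> 'rV[R[i]]_N.+1) : Prop :=
  forall k, {within A, continuous (fun t => complex.Re (l t ord0 k))} /\
            {within A, continuous (fun t => complex.Im (l t ord0 k))}.

End ComplexCalculus.

(** * Paths in projective space

  A path is a function on [0, 1] giving homogeneous coordinates of its points;
  the regularity is that of a suitable lift of the path to the space of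
  homogeneous coordinates, since the given coordinates may jump by a scalar
  factor (as they do when paths are concatenated). *)

Section Paths.
Variables (R : realType) (N : nat).
Implicit Types (S C U : set 'rV[R[i]]_N.+1) (P Q : 'rV[R[i]]_N.+1).
Implicit Types (gamma delta : R -> 'rV[R[i]]_N.+1).

Definition is_path S gamma : Prop :=
  exists l : R -> 'rV[R[i]]_N.+1,
    [/\ coord_continuous (`[0, 1] : set R) l, piecewise_C1 0 1 l &
        forall t, 0 <= t <= 1 -> S (gamma t) /\ (gamma t == l t)%MS].

Definition from_to gamma P Q : Prop := (gamma 0 == P)%MS /\ (gamma 1 == Q)%MS.

Definition is_loop S gamma Q : Prop := is_path S gamma /\ from_to gamma Q Q.

(* a path that lies in S before reaching its endpoint P, which need not be in
   S; it is piecewise C^1 before time 1 and continuous at time 1 *)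
Definition is_path_towards S gamma P : Prop :=
  exists l : R -> 'rV[R[i]]_N.+1,
    [/\ coord_continuous (`[0, 1] : set R) l,
        forall b, 0 <= b < 1 -> piecewise_C1 0 b l,
        forall t, 0 <= t <= 1 -> (gamma t == l t)%MS,
        forall t, 0 <= t < 1 -> S (gamma t) &
        (gamma 1 == P)%MS].

Definition cat_path gamma delta (t : R) : 'rV[R[i]]_N.+1 :=
  if t <= 2^-1 then gamma (2 * t) else delta (2 * t - 1).

Definition rev_path gamma (t : R) : 'rV[R[i]]_N.+1 := gamma (1 - t).

Definition cat_paths Q (s : seq (R -> 'rV[R[i]]_N.+1)) :
    R -> 'rV[R[i]]_N.+1 :=
  foldr cat_path (fun=> Q) s.

Definition trunc_path gamma (tau : R) (t : R) : 'rV[R[i]]_N.+1 :=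
  gamma (tau * t).

(* homotopy with fixed endpoints inside S *)
Definition homotopic S gamma delta : Prop :=
  exists H : R * R -> 'rV[R[i]]_N.+1,
    coord_continuous [set p : R * R | 0 <= p.1 <= 1 /\ 0 <= p.2 <= 1] H /\
    (forall s t, 0 <= s <= 1 -> 0 <= t <= 1 -> S (H (s, t))) /\
    (forall t, 0 <= t <= 1 ->
       [/\ (H (0, t) == gamma t)%MS, (H (1, t) == delta t)%MS,
           (H (t, 0) == gamma 0)%MS & (H (t, 1) == gamma 1)%MS]).

(* U is the open neighbourhood of P in the curve C on which the local
   parameter z at P is a coordinate with values in the disc of radius eps *)
Definition coordinate_disc C P (z : rfrac R[i] N) (eps : R) U : Prop :=
  [/\ [/\ U `<=` C, U P & forall v w, U v -> w != 0 -> (w == v)%MS -> U w],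
      (forall v, U v -> exists2 d : R, 0 < d &
         forall w, C w -> (forall k, `|w ord0 k - v ord0 k| < d%:C%C) -> U w),
      ord_along C (ppoint P) z 1,
      (forall v, U v -> regular_along C (ppoint v) z) &
      (forall v w, U v -> U w -> rf_val C z v = rf_val C z w -> (v == w)%MS) /\
      (forall a : R[i], `|a| < eps%:C%C <-> exists2 v, U v & rf_val C z v = a)].

(* simple loop going once counterclockwise around P in the disc U *)
Definition small_loop C P (z : rfrac R[i] N) U (sigma0 : R -> 'rV[R[i]]_N.+1)
    (B : 'rV[R[i]]_N.+1) : Prop :=
  [/\ is_loop (U `\` ppoint P) sigma0 B,
      (forall t t', 0 <= t < 1 -> 0 <= t' < 1 ->
         (sigma0 t == sigma0 t')%MS -> t = t') &
      dlog_integral 0 1 (fun t => rf_val C z (sigma0 t)) = 2 * ipi R].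

End Paths.

Section Symbol.
Variables (R : realType) (N : nat).

Definition k1 : 'I_3 := @Ordinal 3 0 isT.
Definition k2 : 'I_3 := @Ordinal 3 1 isT.
Definition k3 : 'I_3 := @Ordinal 3 2 isT.

(* C is indexed from 0, and f by 'I_3: f_1, f_2, f_3 are f k1, f k2, f k3 *)
Record surface_data (X : set 'rV[R[i]]_N.+1) (f : 'I_3 -> rfrac R[i] N)
    (r : nat) (C : 'I_r.+1 -> set 'rV[R[i]]_N.+1)
    (n : 'I_3 -> 'I_r.+1 -> int) (x : 'I_r.+1 -> rfrac R[i] N)
    (s : nat) (P : 'I_s -> 'rV[R[i]]_N.+1) (c : 'I_s -> 'I_r.+1) : Prop := {
  sd_variety : variety X;
  sd_dim : has_dim X 2;
  sd_smooth : smooth X;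
  sd_ratfun : forall k, ratfun X (f k);
  sd_nonzero : forall k, ~ vanishes (f k).1 X;
  sd_ord : forall k i, ord_along X (C i) (f k) (n k i);
  sd_components : forall Y, (exists i, Y = C i) <->
    prime_divisor X Y /\ exists k m, ord_along X Y (f k) m /\ m != 0;
  sd_distinct : injective C;
  sd_divisor : forall k, has_divisor X (f k) C (n k);
  sd_nonsingular : forall i, smooth (C i);
  sd_only_two : forall i j k v, C i v -> C j v -> C k v ->
    [\/ i = j, j = k | i = k];
  sd_transverse : forall i j v, i != j -> C i v -> C j v ->
    transverse_at X (C i) (C j) v;
  sd_x : forall i j, ord_along X (C j) (x i) (i == j)%:Z;
  (* the points P_l, with P_l on the intersection of C_0 and C_(c l) *)
  sd_P_in : forall l, [/\ c l != ord0, C ord0 (P l) & C (c l) (P l)];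
  sd_P_distinct : forall l l', (P l == P l')%MS -> l = l';
  sd_P_all : forall j v, j != ord0 -> C ord0 v -> C j v ->
    exists l, (v == P l)%MS;
  sd_x_local : forall l,
    local_equation X (ppoint (P l)) (C ord0) (x ord0) /\
    local_equation X (ppoint (P l)) (C (c l)) (x (c l))
}.

(* f = x0 ^ m * xj ^ n * g *)
Definition cofactor_fun (f x0 xj : rfrac R[i] N) (m n : int) : rfrac R[i] N :=
  rf_mul f (rf_inv (rf_mul (rf_pow x0 m) (rf_pow xj n))).

Definition punctured (C0 : set 'rV[R[i]]_N.+1) (s : nat)
    (P : 'I_s -> 'rV[R[i]]_N.+1) : set 'rV[R[i]]_N.+1 :=
  [set v | C0 v /\ forall l, ~~ (v == P l)%MS].

Definition sigma_loop (gamma sigma0 : R -> 'rV[R[i]]_N.+1) (tau : R) :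
    R -> 'rV[R[i]]_N.+1 :=
  cat_path (trunc_path gamma tau)
    (cat_path sigma0 (rev_path (trunc_path gamma tau))).

Definition generator (g s : nat) (alpha beta : 'I_g -> R -> 'rV[R[i]]_N.+1)
    (sigma : 'I_s -> R -> 'rV[R[i]]_N.+1) (a : 'I_g + 'I_g + 'I_s) :
    R -> 'rV[R[i]]_N.+1 :=
  match a with
  | inl (inl j) => alpha j
  | inl (inr j) => beta j
  | inr l => sigma l
  end.

Definition surface_word (g s : nat) (alpha beta : 'I_g -> R -> 'rV[R[i]]_N.+1)
    (sigma : 'I_s -> R -> 'rV[R[i]]_N.+1) : seq (R -> 'rV[R[i]]_N.+1) :=
  flatten [seq [:: alpha j; beta j; rev_path (alpha j); rev_path (beta j)]
          | j <- enum 'I_g] ++ [seq sigma l | l <- enum 'I_s].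

(* The path gamma_l is given up to its limit point P_l: the point R_l is
   gamma_l(tau_l), and the limit R_l --> P_l is taken along gamma_l, which
   stays in the eps-neighbourhood U of P_l from R_l on.
   The alpha_j, beta_j are loops around the handles in the sense that they
   generate, together with the sigma_l, the fundamental group of C0 minus
   the P_l. *)
Record path_data (C0 : set 'rV[R[i]]_N.+1) (s : nat)
    (P : 'I_s -> 'rV[R[i]]_N.+1) (g : nat) (Q : 'rV[R[i]]_N.+1) (eps : R)
    (alpha beta : 'I_g -> R -> 'rV[R[i]]_N.+1)
    (gamma sigma0 : 'I_s -> R -> 'rV[R[i]]_N.+1) (tau : 'I_s -> R) : Prop := {
  pd_genus : has_genus C0 g;
  pd_Q : punctured C0 P Q;
  pd_eps : 0 < eps;
  pd_alpha : forall j, is_loop (punctured C0 P) (alpha j) Q;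
  pd_beta : forall j, is_loop (punctured C0 P) (beta j) Q;
  pd_gamma : forall l, (gamma l 0 == Q)%MS /\
    is_path_towards (punctured C0 P) (gamma l) (P l);
  pd_tau : forall l, 0 < tau l < 1;
  pd_small : forall l, exists z U,
    [/\ coordinate_disc C0 (P l) z eps U,
        forall l', U (P l') -> l' = l,
        forall t, tau l <= t <= 1 -> U (gamma l t) &
        small_loop C0 (P l) z U (sigma0 l) (gamma l (tau l))];
  pd_relation : homotopic (punctured C0 P)
    (cat_paths Q (surface_word alpha beta
                    (fun l => sigma_loop (gamma l) (sigma0 l) (tau l))))
    (fun=> Q);
  pd_generate : forall delta, is_loop (punctured C0 P) delta Q ->
    exists w : seq (('I_g + 'I_g + 'I_s) * bool),
      homotopic (punctured C0 P) delta
        (cat_paths Q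
           [seq let eta := generator alpha beta
                  (fun l => sigma_loop (gamma l) (sigma0 l) (tau l)) a.1 in
                if a.2 then rev_path eta else eta | a <- w])
}.

Definition restricted_val (X C0 : set 'rV[R[i]]_N.+1) (g : rfrac R[i] N) :
    'rV[R[i]]_N.+1 -> R[i] :=
  rf_val C0 (rf_restrict X C0 g).

Definition avoids_zeros_and_poles (X C0 : set 'rV[R[i]]_N.+1)
    (g : rfrac R[i] N) (gamma : R -> 'rV[R[i]]_N.+1) : Prop :=
  forall t, 0 <= t < 1 ->
    unit_along C0 (ppoint (gamma t)) (rf_restrict X C0 g).

(* the integral of dg/g, restricted to C0, from Q to R_l, in the limit
   R_l --> P_l *)
Definition path_integral_dlog (X C0 : set 'rV[R[i]]_N.+1)
    (g : rfrac R[i] N) (gamma : R -> 'rV[R[i]]_N.+1) : R[i] :=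
  clim_left 1 (fun b =>
    dlog_integral 0 b (fun t => restricted_val X C0 g (gamma t))).

Definition refined_symbol (X : set 'rV[R[i]]_N.+1) (m n : 'I_3 -> int)
    (g : 'I_3 -> rfrac R[i] N) (P : 'rV[R[i]]_N.+1) : R[i] :=
  (-1) ^ (n k1 * n k3 * m k2 - m k1 * m k3 * n k2) *
  (rf_val X (g k1) P ^ n k3 / rf_val X (g k3) P ^ n k1) ^ m k2.

Definition log_refined_symbol (X C0 : set 'rV[R[i]]_N.+1)
    (m n : 'I_3 -> int) (g : 'I_3 -> rfrac R[i] N)
    (gamma : R -> 'rV[R[i]]_N.+1) : R[i] :=
  (2 * ipi R) ^+ 2 *
  (ipi R * (m k2 * n k1 * n k3 - n k2 * m k1 * m k3)%:~R
   + (m k2 * n k3)%:~R * path_integral_dlog X C0 (g k1) gamma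
   - (m k2 * n k1)%:~R * path_integral_dlog X C0 (g k3) gamma).

End Symbol.

(* Main.v *)
(** Near P = P_l the function f_k is a unit times x_0^(m_k) x_j^(n_k), because
  the other components of the divisor do not pass through P and any two local
  equations of C_0 (or of C_j) differ by a unit.  Hence g_k is a unit at P, and
  its restriction phi to C_0, read along gamma_l, is a quotient of polynomials
  in the coordinates of the lifted path, continuous and nonzero up to the
  endpoint.

  On an interval where phi / z stays in the half-plane Re > 0, the integral of
  phi' / phi is a difference of values of the principal logarithm of phi / z.
  With z = phi(t) near each t < 1, these local formulas exponentiate and glue to
  exp (\int_0^b phi' / phi) phi(0) = phi(b) for b < 1.  With z = phi(1) they
  glue on a whole interval [b0, 1[ and show that the integral has a limit at 1,
  so that exp (\int_gamma dg/g) g(Q) = g(P).  The formula for the symbol follows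
  by taking powers, the sign being a power of exp (pi i) = -1. *)

Require Import Defs.
From HB Require Import structures.
From mathcomp Require Import all_boot all_order all_algebra.
From mathcomp Require Import -(notations) mpoly.
From mathcomp Require Import all_classical all_reals all_analysis.
From mathcomp Require Import measurable_realfun complex.
From mathcomp Require Import ring lra.

Set Implicit Arguments.
Unset Strict Implicit.
Unset Printing Implicit Defensive.
Import Order.TTheory GRing.Theory Num.Theory numFieldNormedType.Exports.
Local Open Scope classical_set_scope.
Local Open Scope ring_scope.

(** * Fractions as generically defined functions *)

Section GenericFunctions.
Variables (K : fieldType) (N : nat).
Implicit Types (F H : hpoly K N) (v w P : 'rV[K]_N.+1).
Implicit Types (Z W Y : set 'rV[K]_N.+1) (f g h u : rfrac K N).

Definition hom F := exists d, homog d F.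

Definition nonzero_on Z F := hom F /\ ~ vanishes F Z.

(** Since [0^-1 = 0] in the field, this value is total and commutes with products, inverses and
    powers of fractions without any condition on the denominators. *)
Definition rf_at f v := hev f.1 v / hev f.2 v.

(** Agreement off a proper closed subset. It makes sense for arbitrary pairs of polynomials, so it
    passes to products and powers without a check on the denominators; between rational functions on
    a variety it amounts to [rf_eq]. *)
Definition gen_eq Z f g :=
  exists2 H, nonzero_on Z H &
    forall v, Z v -> hev H v != 0 -> rf_at f v = rf_at g v.

Lemma hevB v : {morph (@hev K N)^~ v : F H / F - H}.
Proof. by move=> F H; rewrite /hev mevalB. Qed.

Lemma hevM v : {morph (@hev K N)^~ v : F H / F * H}.
Proof. by move=> F H; rewrite /hev mevalM. Qed.

Lemma hev1 v : hev 1 v = 1.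
Proof. by rewrite /hev meval1. Qed.

Lemma hevXn v F k : hev (F ^+ k) v = hev F v ^+ k.
Proof. by elim: k => [|k IH]; rewrite ?expr0 ?hev1// !exprS hevM IH. Qed.

Lemma hevZ d F a v : homog d F -> hev F (a *: v) = a ^+ d * hev F v.
Proof.
move=> /dhomogP hF; rewrite /hev !mevalE mulr_sumr.
rewrite big_seq [RHS]big_seq; apply: eq_bigr => m mF.
rewrite mulrCA; congr (_ * _); under eq_bigr do rewrite mxE exprMn.
rewrite big_split/=; congr (_ * _).
by move: (hF _ mF) => /= <-; rewrite mdegE expr_sum.
Qed.

Lemma eqmx_scale v w : v != 0 -> (w == v)%MS ->
  exists2 a, a != 0 & v = a *: w.
Proof.
move=> v0 /andP[_ /sub_rVP[a e]]; exists a => //.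
by apply: contra_neq v0 => a0; rewrite e a0 scale0r.
Qed.

Lemma hev_eq0 F v w : hom F -> v != 0 -> (w == v)%MS ->
  (hev F v == 0) = (hev F w == 0).
Proof.
move=> [d hF] v0 wv; have [a a0 ->] := eqmx_scale v0 wv.
by rewrite (hevZ _ _ hF) mulf_eq0 expf_eq0 (negbTE a0) andbF.
Qed.

Definition hom2 f := exists d, homog d f.1 /\ homog d f.2.

Lemma hom21 f : hom2 f -> hom f.1. Proof. by case=> d []; exists d. Qed.
Lemma hom22 f : hom2 f -> hom f.2. Proof. by case=> d []; exists d. Qed.

Lemma rf_at_scale f v w : hom2 f -> v != 0 -> (w == v)%MS ->
  rf_at f v = rf_at f w.
Proof.
move=> [d [h1 h2]] v0 wv; have [a a0 ->] := eqmx_scale v0 wv.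
by rewrite /rf_at (hevZ _ _ h1) (hevZ _ _ h2) -mulf_div divff ?mul1r ?expf_neq0.
Qed.

Lemma homM F H : hom F -> hom H -> hom (F * H).
Proof. by move=> [d hF] [e hH]; exists (d + e)%N; apply: dhomogM. Qed.

Lemma hom1 : hom (1 : hpoly K N).
Proof. by exists 0%N; apply: dhomog1. Qed.

Lemma hom2M f g : hom2 f -> hom2 g -> hom2 (rf_mul f g).
Proof.
by move=> [d [f1 f2]] [e [g1 g2]]; exists (d + e)%N; split; apply: dhomogM.
Qed.

Lemma hom2V f : hom2 f -> hom2 (rf_inv f).
Proof. by move=> [d [f1 f2]]; exists d. Qed.

Lemma hom2_const a : hom2 (rf_const N a).
Proof.
exists 0%N; split; last exact: dhomog1.
apply/dhomogP => m; rewrite /= msuppC; case: ifP => // _.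
by rewrite inE => /eqP ->; exact: mdeg0.
Qed.

Lemma hom2_pow f n : hom2 f -> hom2 (rf_pow f n).
Proof.
move=> [d [f1 f2]].
by case: n => k; [exists (d * k)%N | exists (d * k.+1)%N];
   split; apply: dhomogMn.
Qed.

Lemma hom_cross f g : hom2 f -> hom2 g -> hom (f.1 * g.2 - g.1 * f.2).
Proof.
move=> [d [f1 f2]] [e [g1 g2]]; exists (d + e)%N.
by apply: rpredB; [|rewrite addnC]; apply: dhomogM.
Qed.

Lemma rf_atM f g v : rf_at (rf_mul f g) v = rf_at f v * rf_at g v.
Proof. by rewrite /rf_at/= !hevM mulf_div. Qed.

Lemma rf_atV f v : rf_at (rf_inv f) v = (rf_at f v)^-1.
Proof. by rewrite /rf_at/= invf_div. Qed.

Lemma rf_at_const a v : rf_at (rf_const N a) v = a.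
Proof. by rewrite /rf_at/= /hev mevalC meval1 divr1. Qed.

Lemma rf_at_pow f n v : rf_at (rf_pow f n) v = rf_at f v ^ n.
Proof.
rewrite /rf_at; case: n => k /=; rewrite !hevXn.
  by rewrite -exprnP expr_div_n.
by rewrite NegzE -exprnN -expr_div_n -exprVn invf_div.
Qed.

Lemma ppoint_nonzero F P : hom F -> ~ vanishes F (ppoint P) -> hev F P != 0.
Proof.
move=> hF; apply: contra_notN => /eqP FP v [v0 vP].
have Pv : (P == v)%MS by rewrite andbC.
by apply/eqP; rewrite (hev_eq0 hF v0 Pv) FP.
Qed.

Lemma nonvanishing F Z v : Z v -> hev F v != 0 -> ~ vanishes F Z.
Proof. by move=> Zv /eqP F0 /(_ _ Zv). Qed.

Lemma nonvanishingP F Z : ~ vanishes F Z -> exists2 v, Z v & hev F v != 0.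
Proof.
move=> nF; apply: contrapT => H; apply: nF => v Zv; apply/eqP/negPn/negP => Fv.
by apply: H; exists v.
Qed.

Lemma variety_neq0 Z v : variety Z -> Z v -> v != 0.
Proof. by case=> -[S _ ->] _ _ []. Qed.

Lemma proj_closed_zeros F : hom F -> proj_closed (proj_zeros [set F]).
Proof. by move=> hF; exists [set F] => // _ ->. Qed.

(** * Generic equality on an irreducible set *)

Section Variety.
Variable Z : set 'rV[K]_N.+1.
Hypothesis hZ : variety Z.

(** This is irreducibility: if [F * H] vanished on [Z], the closed sets [F = 0] and [H = 0] would
    cover [Z], so one of them would contain it. *)
Lemma nonzero_onM F H :
  nonzero_on Z F -> nonzero_on Z H -> nonzero_on Z (F * H).
Proof.
move=> [hF nF] [hH nH]; split; first exact: homM.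
move=> FH; have [_ _ irr] := hZ.
have [|ZF|ZH] := irr _ _ (proj_closed_zeros hF) (proj_closed_zeros hH).
- move=> v Zv; have /eqP := FH v Zv; rewrite hevM mulf_eq0.
  by case/orP=> /eqP e; [left|right]; (split; [exact: variety_neq0 Zv|]) => _ ->.
- by apply: nF => v /ZF[_]; apply.
- by apply: nH => v /ZH[_]; apply.
Qed.

Lemma nonzero_on1 : nonzero_on Z 1.
Proof.
split; first exact: hom1.
have [_ [v Zv] _] := hZ.
by apply: nonvanishing Zv _; rewrite hev1 oner_neq0.
Qed.

Lemma gen_eq_refl f : gen_eq Z f f.
Proof. by exists 1 => //; exact: nonzero_on1. Qed.

Lemma gen_eq_sym f g : gen_eq Z f g -> gen_eq Z g f.
Proof. by move=> [H nH e]; exists H => // v Zv Hv; rewrite e. Qed.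

Lemma gen_eq_trans f g h : gen_eq Z f g -> gen_eq Z g h -> gen_eq Z f h.
Proof.
move=> [H nH e] [H' nH' e']; exists (H * H'); first exact: nonzero_onM.
by move=> v Zv; rewrite hevM mulf_eq0 negb_or => /andP[? ?]; rewrite e// e'.
Qed.

Lemma gen_eqM f f' g g' : gen_eq Z f f' -> gen_eq Z g g' ->
  gen_eq Z (rf_mul f g) (rf_mul f' g').
Proof.
move=> [H nH e] [H' nH' e']; exists (H * H'); first exact: nonzero_onM.
move=> v Zv; rewrite hevM mulf_eq0 negb_or => /andP[? ?].
by rewrite rf_atM rf_atM (e v)// (e' v).
Qed.

Lemma gen_eq_pow f f' n : gen_eq Z f f' -> gen_eq Z (rf_pow f n) (rf_pow f' n).
Proof.
move=> [H nH e]; exists H; [exact: nH|move=> v Zv Hv].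
by rewrite rf_at_pow rf_at_pow (e v).
Qed.

Lemma gen_eq_at f g : (forall v, Z v -> rf_at f v = rf_at g v) -> gen_eq Z f g.
Proof. by move=> e; exists 1 => [|v Zv _]; [exact: nonzero_on1|exact: e]. Qed.

Lemma ratfun_nonzero f : ratfun Z f -> nonzero_on Z f.2.
Proof. by move=> [/hom22]. Qed.

Lemma rf_eq_gen f g : ratfun Z f -> ratfun Z g -> rf_eq Z f g -> gen_eq Z f g.
Proof.
move=> rf rg e; exists (f.2 * g.2).
  exact: nonzero_onM (ratfun_nonzero rf) (ratfun_nonzero rg).
move=> v Zv; rewrite hevM mulf_eq0 negb_or => /andP[f0 g0].
apply/eqP; rewrite eqr_div//; apply/eqP.
by have := e v Zv; rewrite hevB !hevM => /eqP; rewrite subr_eq0 => /eqP.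
Qed.

(** If the cross difference did not vanish on [Z], irreducibility would give a point where it, [H]
    and both denominators are all nonzero; but there the equality of values makes it zero. *)
Lemma gen_rf_eq f g : ratfun Z f -> ratfun Z g -> gen_eq Z f g -> rf_eq Z f g.
Proof.
move=> rf rg [H nH e]; apply: contrapT => nE.
have nE' : nonzero_on Z (f.1 * g.2 - g.1 * f.2).
  by split=> //; case: rf rg => rf _ [rg _]; apply: hom_cross.
have [|v Zv] := @nonvanishingP ((f.1 * g.2 - g.1 * f.2) * (H * (f.2 * g.2))) Z.
  apply: (nonzero_onM nE' (nonzero_onM nH _)).2.
  exact: nonzero_onM (ratfun_nonzero rf) (ratfun_nonzero rg).
rewrite 3!hevM !mulf_eq0 !negb_or => /and4P[+ Hv f0 g0] => /eqP; apply.
have /eqP := e v Zv Hv; rewrite eqr_div// => /eqP fg.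
by rewrite hevB !hevM fg subrr.
Qed.

Lemma ratfunM f g : ratfun Z f -> ratfun Z g -> ratfun Z (rf_mul f g).
Proof.
move=> rf rg; split; first by case: rf rg => rf _ [rg _]; apply: hom2M.
exact: (nonzero_onM (ratfun_nonzero rf) (ratfun_nonzero rg)).2.
Qed.

Lemma nonzero_onX F k : nonzero_on Z F -> nonzero_on Z (F ^+ k).
Proof.
move=> nF; elim: k => [|k IH]; first by rewrite expr0; exact: nonzero_on1.
by rewrite exprS; apply: nonzero_onM.
Qed.

(** The nonzero elements of the function field: inverses and negative powers of these are again
    rational functions. *)
Definition nzratfun f := ratfun Z f /\ ~ vanishes f.1 Z.

Lemma nzratfunV f : nzratfun f -> nzratfun (rf_inv f).
Proof. by move=> [[[d [? ?]] ?] ?]; split=> //; split=> //; exists d. Qed.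

Lemma nzratfunM f g : nzratfun f -> nzratfun g -> nzratfun (rf_mul f g).
Proof.
move=> [rf nf] [rg ng]; split; first exact: ratfunM.
by apply: (nonzero_onM _ _).2; split=> //; [case: rf | case: rg] => /hom21.
Qed.

Lemma nzratfun_pow f n : nzratfun f -> nzratfun (rf_pow f n).
Proof.
move=> [rf nf]; have hf : hom2 f by case: rf.
have nf1 : nonzero_on Z f.1 by split=> //; exact: hom21.
have nf2 := ratfun_nonzero rf.
by case: n => k; do ![split]; do ?[exact: (hom2_pow (Posz k))];
  do ?[exact: (hom2_pow (Negz k))]; apply: (nonzero_onX _ _).2.
Qed.

End Variety.
End GenericFunctions.

(** * Units at a point *)

Section Units.
Variables (K : fieldType) (N : nat) (X : set 'rV[K]_N.+1).
Hypothesis hX : variety X.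
Implicit Types (F H : hpoly K N) (v w P : 'rV[K]_N.+1).
Implicit Types (Y : set 'rV[K]_N.+1) (f g h u t x : rfrac K N).

(** A variant of [unit_along] in terms of [gen_eq]: no condition is put on the denominator of [f]
    itself, so units are multiplied and raised to powers by working on the representative [h]
    alone. *)
Definition unit_at P f :=
  exists h, [/\ hom2 h, gen_eq X f h, hev h.1 P != 0 & hev h.2 P != 0].

Lemma unit_at_gen P f g : gen_eq X f g -> unit_at P g -> unit_at P f.
Proof.
by move=> fg [h [hh gh h1 h2]]; exists h; split=> //; exact: gen_eq_trans fg gh.
Qed.

Lemma unit_atM P f g : unit_at P f -> unit_at P g -> unit_at P (rf_mul f g).
Proof.
move=> [h [hh fh h1 h2]] [k [hk gk k1 k2]]; exists (rf_mul h k); split.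
- exact: hom2M.
- exact: gen_eqM.
- by rewrite hevM mulf_neq0.
- by rewrite hevM mulf_neq0.
Qed.

Lemma unit_at_pow P f n : unit_at P f -> unit_at P (rf_pow f n).
Proof.
move=> [h [hh fh h1 h2]]; exists (rf_pow h n); split.
- exact: hom2_pow.
- exact: gen_eq_pow.
- by case: n => k; rewrite hevXn expf_neq0.
- by case: n => k; rewrite hevXn expf_neq0.
Qed.

Lemma unit_at1 P : unit_at P (rf_const N 1).
Proof.
exists (rf_const N 1); split; [exact: hom2_const|exact: gen_eq_refl| |].
  by rewrite /= /hev mevalC oner_neq0.
by rewrite /= hev1 oner_neq0.
Qed.

Lemma germ_gen W f h : germ X W f h -> gen_eq X f h.
Proof. by move=> [rf rh e _]; exact: rf_eq_gen. Qed.

Lemma germ_hom2 W f h : germ X W f h -> hom2 h.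
Proof. by move=> [_ []]. Qed.

Lemma germ_den P f h : germ X (ppoint P) f h -> hev h.2 P != 0.
Proof. by move=> [_ [/hom22 hh _] _]; exact: ppoint_nonzero. Qed.

Lemma unit_along_at P u : unit_along X (ppoint P) u -> unit_at P u.
Proof.
move=> [h gh h1]; exists h; split; [exact: germ_hom2 gh|exact: germ_gen gh| |].
  by apply: ppoint_nonzero h1; apply: hom21; exact: germ_hom2 gh.
exact: germ_den gh.
Qed.

(** At a generic point the value of [f] is that of [h], whose numerator and denominator, nonzero at
    [P], do not vanish identically on [X]. *)
Lemma unit_at_nonzero P f : X P -> hom2 f -> unit_at P f -> ~ vanishes f.1 X.
Proof.
move=> XP hf [h [hh [H nH e] h1 h2]].
have nh1 : nonzero_on X h.1.
  by split; [exact: hom21|exact: nonvanishing XP h1].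
have nh2 : nonzero_on X h.2.
  by split; [exact: hom22|exact: nonvanishing XP h2].
have [v Xv] := nonvanishingP (nonzero_onM hX nH (nonzero_onM hX nh1 nh2)).2.
rewrite 2!hevM !mulf_eq0 !negb_or => /and3P[Hv h1v h2v].
apply: (nonvanishing Xv); apply/eqP => f0; have := e v Xv Hv.
by move/eqP; rewrite /rf_at f0 mul0r eq_sym mulf_eq0 invr_eq0 (negbTE h1v) (negbTE h2v).
Qed.

Lemma gen_eq_divr t x h : nzratfun X x -> gen_eq X t (rf_mul x h) ->
  gen_eq X (rf_mul t (rf_inv x)) h.
Proof.
move=> [rx nx] [H nH e]; exists (H * (x.1 * x.2)).
  apply: (nonzero_onM hX nH); apply: (nonzero_onM hX _ (ratfun_nonzero rx)).
  by split=> //; apply: hom21; case: rx.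
move=> v Xv; rewrite 2!hevM !mulf_eq0 !negb_or => /and3P[Hv x1 x2].
rewrite rf_atM rf_atV e// rf_atM mulrAC divff ?mul1r//.
by rewrite /rf_at mulf_neq0 ?invr_eq0.
Qed.

(** Clearing denominators turns a generic equality into a polynomial identity on all of [X], which
    can be read at the given point [P]. *)
Lemma gen_eq_eval P f g : X P -> ratfun X f -> ratfun X g -> gen_eq X f g ->
  hev f.1 P * hev g.2 P = hev g.1 P * hev f.2 P.
Proof.
move=> XP rf rg /(gen_rf_eq hX rf rg)/(_ P XP).
by rewrite hevB !hevM => /eqP; rewrite subr_eq0 => /eqP.
Qed.

Lemma ratfun_hom2 P h : X P -> hom2 h -> hev h.2 P != 0 -> ratfun X h.
Proof. by move=> XP hh h2; split=> //; exact: nonvanishing XP h2. Qed.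

Lemma local_equation_factor P Y t f : local_equation X (ppoint P) Y t ->
    in_ideal X (ppoint P) Y f ->
  exists h, [/\ ratfun X h, hev h.2 P != 0 & gen_eq X f (rf_mul t h)].
Proof.
move=> [[ht [rt _ _ _] _] gt] If; have [u [h gh] e] := gt f If.
have [rf] : ratfun X f by case: If => ? [].
case: (gh) => ru rh _ _; exists h; split=> //; first exact: germ_den gh.
have : gen_eq X f (rf_mul t u) by apply: rf_eq_gen => //; exact: ratfunM.
move/(gen_eq_trans hX); apply; apply: gen_eqM => //; first exact: gen_eq_refl.
exact: germ_gen gh.
Qed.

(** Each equation is a regular multiple of the other, [x = t h] and [t = x k]. Hence [k h = 1]
    generically, and reading this at [P] shows that [k] is nonzero there. *)
Lemma unit_at_local_equations P Y t x : X P -> nzratfun X x ->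
    local_equation X (ppoint P) Y t -> local_equation X (ppoint P) Y x ->
  unit_at P (rf_mul t (rf_inv x)).
Proof.
move=> XP nx lt lx.
have [h [rh h2 xth]] := local_equation_factor lt lx.1.
have [k [rk k2 txk]] := local_equation_factor lx lt.1.
exists k; split=> //; [by case: rk|exact: gen_eq_divr|].
have rhk := ratfunM hX rk rh.
have r1 : ratfun X (rf_const N 1).
  by apply: (ratfun_hom2 XP); [exact: hom2_const|rewrite /= hev1 oner_neq0].
have : gen_eq X (rf_mul k h) (rf_const N 1).
  apply: (gen_eq_trans hX (g := rf_mul x (rf_inv x))).
    apply: gen_eq_sym; apply: gen_eq_divr => //.
    apply: (gen_eq_trans hX xth).
    apply: (gen_eq_trans hX (gen_eqM hX txk (gen_eq_refl hX h))).
    by apply: gen_eq_at => // v _; rewrite !rf_atM mulrA.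
  apply: gen_eq_divr => //; apply: gen_eq_at => // v _.
  by rewrite rf_atM rf_at_const mulr1.
move/(gen_eq_eval XP rhk r1); have c1 : hev (rf_const N (1 : K)).1 P = 1 by rewrite /hev mevalC.
rewrite c1 ?hev1 mulr1 mul1r /= !hevM => e; apply/eqP => k0.
by move/eqP: e; rewrite k0 mul0r eq_sym mulf_eq0 (negbTE h2) (negbTE k2).
Qed.

(** Some equation [F] of [Y] is nonzero at [P]. It gives an element of the ideal of [Y] with nonzero
    value at [P], and [t] divides it in the local ring. *)
Lemma unit_at_off_divisor P Y t : X P -> proj_closed Y -> ~ Y P ->
  local_equation X (ppoint P) Y t -> unit_at P t.
Proof.
move=> XP [S hS eY] nYP lt; have P0 := variety_neq0 hX XP.
have [F [SF FP]] : exists F, S F /\ hev F P != 0.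
  apply: contrapT => nF; apply: nYP; rewrite eY; split=> // F SF.
  by apply/eqP/negPn/negP => FP; apply: nF; exists F.
have [a Pa] : exists a, P ord0 a != 0 by apply/rV0Pn.
have [d hF] := hS F SF.
(* Dividing by the [d]-th power of a coordinate that is nonzero at [P] makes [F] a function of
   degree 0, regular at [P]. *)
pose k : rfrac K N := (F, mpolyX K (mnm1 a) ^+ d).
have k2 : hev k.2 P != 0.
  by rewrite /= hevXn expf_neq0// /hev mevalXU.
have rk : ratfun X k.
  apply: (ratfun_hom2 XP) => //; exists d; split=> //=.
  have : homog 1 (mpolyX K (mnm1 a)) by rewrite /homog dhomogX /= mdeg1.
  by move=> /(dhomogMn d); rewrite mul1n.
have /(local_equation_factor lt)[h [rh h2 e]] : in_ideal X (ppoint P) Y k.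
  exists k; first split=> //; first by move=> v _; rewrite hevB subrr.
    by apply: nonvanishing k2; split=> //; rewrite submx_refl.
  by move=> v; rewrite eY => -[_ /(_ _ SF)].
have [g gg _] := lt.1; have [rt rg _ _] := gg.
exists g; split; [by case: rg|exact: germ_gen gg| |exact: germ_den gg].
have := gen_eq_eval XP rk (ratfunM hX rg rh) (gen_eq_trans hX e
  (gen_eqM hX (germ_gen gg) (gen_eq_refl hX h))).
rewrite /= !hevM => e'; apply/eqP => g0; move/eqP: e'.
rewrite g0 !mul0r mulf_eq0 (negbTE FP) mulf_eq0 (negbTE h2).
by rewrite (negbTE (germ_den gg)).
Qed.

Lemma rf_at_big (I : Type) (s : seq I) (p : pred I) (t : I -> rfrac K N) v :
  rf_at (\big[@rf_mul K N/rf_const N 1]_(i <- s | p i) t i) v =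
  \prod_(i <- s | p i) rf_at (t i) v.
Proof.
by apply: (big_morph (fun f => rf_at f v)) => [f g|];
  [exact: rf_atM|exact: rf_at_const].
Qed.

(** Local equations of the components that miss [P] are units there, and those of the two remaining
    components differ from [x] and [y] by units, so the quotient is a product of units. *)
Lemma cofactor_unit P r (C : 'I_r -> set 'rV[K]_N.+1) (n : 'I_r -> int)
    (f x y : rfrac K N) (i j : 'I_r) :
    X P -> ratfun X f -> has_divisor X f C n -> i != j ->
    (forall k, proj_closed (C k)) ->
    (forall k, k != i -> k != j -> ~ C k P) ->
    nzratfun X x -> local_equation X (ppoint P) (C i) x ->
    nzratfun X y -> local_equation X (ppoint P) (C j) y ->
  unit_at P (rf_mul f (rf_inv (rf_mul (rf_pow x (n i)) (rf_pow y (n j))))).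
Proof.
move=> XP rf div ij cC nC nx lx ny ly.
have [t [u [lt /[dup] uu /unit_along_at uP e]]] := div P XP.
have rt k : ratfun X (t k) by case: (lt k) => -[? []].
have tx := unit_at_local_equations XP nx (lt i) lx.
have ty := unit_at_local_equations XP ny (lt j) ly.
have hrt k : hom2 (t k) by case: (rt k).
(* Exponents may be negative, so each [t k] has to be nonzero for the product of the powers to be a
   rational function. *)
have nt k : nzratfun X (t k).
  split=> //.
  have [->|ki] := eqVneq k i.
    have hx : hom2 x by case: nx => -[].
    have := unit_at_nonzero XP (hom2M (hrt i) (hom2V hx)) tx.
    by apply: contra_not => t0 v Xv; rewrite /= hevM t0 ?mul0r.
  have [->|kj] := eqVneq k j.
    have hy : hom2 y by case: ny => -[].
    have := unit_at_nonzero XP (hom2M (hrt j) (hom2V hy)) ty.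
    by apply: contra_not => t0 v Xv; rewrite /= hevM t0 ?mul0r.
  apply: (unit_at_nonzero XP (hrt k)).
  exact: (unit_at_off_divisor XP (cC k) (nC k ki kj)).
have ru : ratfun X u by case: uu => ? [].
set prod := \big[_/_]_(_ < _) _ in e.
have rprod : ratfun X prod.
  have [] // : nzratfun X prod.
  apply: big_ind => [|? ? |k _]; [|exact: nzratfunM|exact: nzratfun_pow].
  have h1 := hom2_const N (1 : K).
  split; [split=> //|]; apply: (nonvanishing XP).
    by rewrite hev1 oner_neq0.
  by rewrite /hev mevalC oner_neq0.
have [H nH eH] := rf_eq_gen hX rf (ratfunM hX ru rprod) e.
pose rest := \big[@rf_mul K N/rf_const N 1]_(k < r | (k != i) && (k != j))
  rf_pow (t k) (n k).
(* The factors are regrouped as [u], the components off [P], and powers of the quotients [t i / x]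
   and [t j / y]. *)
apply: (unit_at_gen (g := rf_mul (rf_mul u rest)
  (rf_mul (rf_pow (rf_mul (t i) (rf_inv x)) (n i))
          (rf_pow (rf_mul (t j) (rf_inv y)) (n j))))); last first.
  apply: unit_atM; apply: unit_atM => //; do ?exact: unit_at_pow.
  apply: big_ind => [|? ? |k /andP[ki kj]]; [exact: unit_at1|exact: unit_atM|].
  apply: unit_at_pow; exact: (unit_at_off_divisor XP (cC k) (nC k ki kj)).
exists H; [exact: nH|move=> v Xv Hv].
rewrite rf_atM rf_atV rf_atM (rf_at_pow x) (rf_at_pow y).
rewrite (eH v Xv Hv) !rf_atM /prod /rest !rf_at_big !rf_at_pow !rf_atM !rf_atV.
rewrite (bigD1 i)//= (bigD1 j)/= 1?eq_sym// !rf_at_pow.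
move: (rf_at u v) (rf_at x v) (rf_at y v) (rf_at (t i) v) (rf_at (t j) v).
move: (\prod_(_ < _ | _) _) => B U x0 y0 ti tj.
by rewrite !expfzMl !exprz_inv -!invr_expz invfM; ring.
Qed.

End Units.

(** * The complex logarithm and path integrals *)

Section ComplexLogarithm.
Variable R : realType.
Implicit Types (z w : R[i]) (t a b : R).

Lemma cexpD z w : cexp (z + w) = cexp z * cexp w.
Proof.
case: z w => [a b] [c d]; rewrite /cexp /= expRD cosD sinD.
by apply/eqP; rewrite eq_complex /=; apply/andP; split; apply/eqP; ring.
Qed.

Lemma cexp0 : cexp (0 : R[i]) = 1.
Proof.
rewrite /cexp /= expR0 cos0 sin0.
by apply/eqP; rewrite eq_complex /=; apply/andP; split; apply/eqP; ring.
Qed.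

Lemma cexp_neq0 z : cexp z != 0.
Proof.
apply/eqP => e; have := cexpD z (- z).
by rewrite subrr cexp0 e mul0r => /eqP; rewrite oner_eq0.
Qed.

Lemma cexpN z : cexp (- z) = (cexp z)^-1.
Proof.
have z0 := cexp_neq0 z; apply: (mulfI z0).
by rewrite divff// -cexpD subrr cexp0.
Qed.

Lemma cexpMz (n : int) z : cexp (n%:~R * z) = cexp z ^ n.
Proof.
have H k : cexp (k%:R * z) = cexp z ^+ k.
  elim: k => [|k IH]; first by rewrite mul0r cexp0.
  by rewrite exprS -IH -cexpD -{2}[z]mul1r -mulrDl -mulrS.
case: n => k; first exact: H.
by rewrite NegzE mulrNz mulNr cexpN [cexp (_ * _)]H -exprnN.
Qed.

Lemma cexp_ipi : cexp (ipi R) = -1.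
Proof.
rewrite /cexp /= cospi sinpi expR0.
by apply/eqP; rewrite eq_complex /=; apply/andP; split; apply/eqP; ring.
Qed.

(* the principal branch, on the half-plane Re z > 0 *)
Definition clog z : R[i] :=
  Complex (ln (complex.Re z ^+ 2 + complex.Im z ^+ 2) / 2)
          (atan (complex.Im z / complex.Re z)).

(** Polar coordinates: with [n2 = x ^+ 2 + y ^+ 2], the modulus is [expR (ln n2 / 2)], and for a
    positive real part the arctangent is an argument, with cosine [x / sqrt n2] and sine
    [y / sqrt n2]. *)
Lemma clogK z : 0 < complex.Re z -> cexp (clog z) = z.
Proof.
case: z => x y /= x0; rewrite /cexp /=.
set n2 := x ^+ 2 + y ^+ 2; have n20 : 0 < n2.
  by rewrite ltr_pwDl ?exprn_gt0// sqr_ge0.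
have xy : 1 + (y / x) ^+ 2 = n2 / x ^+ 2 by rewrite /n2; field; rewrite gt_eqF.
have cE : cos (atan (y / x)) = x / Num.sqrt n2.
  rewrite cos_atan xy sqrtrM ?ltW// sqrtrV ?sqr_ge0// sqrtr_sqr gtr0_norm//.
  by rewrite invf_div.
have sE : sin (atan (y / x)) = y / Num.sqrt n2.
  have c0 : cos (atan (y / x)) != 0 by rewrite cE mulf_neq0 ?invr_eq0 ?gt_eqF ?sqrtr_gt0.
  have := atanK (y / x); rewrite /tan => /(canRL (divfK c0)) ->.
  by rewrite cE mulrA divfK ?gt_eqF.
have eE : expR (ln n2 / 2) = Num.sqrt n2.
  apply/eqP; rewrite -(@eqrXn2 _ 2)// ?expR_ge0 ?sqrtr_ge0//.
  by rewrite sqr_sqrtr ?ltW// -expRM_natr divfK ?pnatr_eq0// lnK.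
have s0 : Num.sqrt n2 != 0 by rewrite gt_eqF ?sqrtr_gt0.
rewrite eE cE sE; apply/eqP; rewrite eq_complex /=.
by apply/andP; split; apply/eqP; field.
Qed.

Lemma clog1 : clog 1 = 0.
Proof.
by rewrite /clog /= expr0n /= addr0 expr1n ln1 mul0r mul0r atan0.
Qed.

End ComplexLogarithm.

(** * Real integrals on compact intervals *)

Section IntegralsOnIntervals.
Variable R : realType.
Implicit Types (f g F : R -> R) (a b c t : R).
Local Notation mu := (@lebesgue_measure R).

(** The endpoints are negligible. The open interval appears because a function known on [[a, b]] has
    its derivative determined only at interior points. *)
Lemma integral_congr_oo a b f g :
    {in `]a, b[, f =1 g} -> mu.-integrable `[a, b] (EFin \o f) ->
  mu.-integrable `[a, b] (EFin \o g) /\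
  \int[mu]_(t in `[a, b]) g t = \int[mu]_(t in `[a, b]) f t.
Proof.
move=> fg fi.
have fo : mu.-integrable `]a, b[ (EFin \o f).
  by apply: integrableS fi => //; exact: subset_itv_oo_cc.
have go : mu.-integrable `]a, b[ (EFin \o g).
  by apply: eq_integrable fo => // t; rewrite inE/= => tab; rewrite fg.
have [/measurable_EFinP mfo _] := integrableP _ _ _ fo.
have [mgo goo] := integrableP _ _ _ go.
split.
  apply/integrableP; split; first exact: (emeasurable_fun_itv_cc mgo).
  rewrite (@integral_itv_bndoo _ _ _ (fun t => `|(EFin \o g) t|%E)) //.
  exact: measurableT_comp mgo.
rewrite /Rintegral (@eq_integral_itv_bounded _ _ _ f g)//.
  by apply/measurable_EFinP.
by move=> t tab; rewrite fg.
Qed.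

Lemma FTC_C1 a b f F : a < b ->
    (forall t, a <= t <= b -> is_derive t 1 F (f t) /\ {for t, continuous f}) ->
  mu.-integrable `[a, b] (EFin \o f) /\
  \int[mu]_(t in `[a, b]) f t = F b - F a.
Proof.
move=> ab H.
have cf : {within `[a, b], continuous f}.
  apply: continuous_in_subspaceT => t.
  by rewrite inE/= in_itv/= => /H[].
have cF t : a <= t <= b -> {for t, continuous F}.
  move=> /H[[dF _] _].
  by apply/differentiable_continuous/derivable1_diffP.
split.
  by apply: continuous_compact_integrable => //; exact: segment_compact.
rewrite /Rintegral (continuous_FTC2 ab cf (F := F))//.
- split.
  + by move=> t; rewrite in_itv/= => /andP[/ltW ta /ltW tb]; case: (H t _).1; rewrite ?ta.
  + by apply: cvg_at_right_filter; apply: cF; rewrite lexx ltW.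
  + by apply: cvg_at_left_filter; apply: cF; rewrite lexx ltW.
- move=> t; rewrite in_itv/= => /andP[/ltW ta /ltW tb].
  by rewrite derive1E; case: (H t _).1; rewrite ?ta.
Qed.

Lemma integral_cat a b c f : a <= b -> b <= c ->
    mu.-integrable `[a, b] (EFin \o f) -> mu.-integrable `[b, c] (EFin \o f) ->
  mu.-integrable `[a, c] (EFin \o f) /\
  \int[mu]_(t in `[a, c]) f t =
  \int[mu]_(t in `[a, b]) f t + \int[mu]_(t in `[b, c]) f t.
Proof.
move=> ab bc f1 f2.
(* Dropping [b] from the second interval makes the union disjoint. *)
have f2' : mu.-integrable `]b, c] (EFin \o f).
  by apply: integrableS f2 => //; exact: subset_itv_oc_cc.
have E : `[a, c]%classic = `[a, b] `|` `]b, c].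
  by rewrite -itv_bndbnd_setU// bnd_simp.
have fi : mu.-integrable `[a, c] (EFin \o f).
  have [m1 i1] := integrableP _ _ _ f1; have [m2 i2] := integrableP _ _ _ f2'.
  rewrite E; apply/integrableP.
  have m12 : measurable_fun (`[a, b] `|` `]b, c]) (EFin \o f).
    exact/measurable_funU.
  split=> //; rewrite ge0_integral_setU//; first exact: lte_add_pinfty.
    exact: measurableT_comp m12.
  by apply/disj_setPS => y [/=]; rewrite !in_itv/= => /andP[_ yb] /andP[]; rewrite ltNge yb.
split=> //.
have /(_ b) := Rintegral_itvB fi; rewrite !bnd_simp => /(_ ab bc).
rewrite Rintegral_itv_obnd_cbnd// => <-.
by rewrite addrC subrK.
Qed.

Lemma integrable_point a f : mu.-integrable `[a, a] (EFin \o f).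
Proof.
rewrite set_itv1.
apply/integrableP; split; first exact: measurable_fun_set1.
by rewrite integral_set1.
Qed.

End IntegralsOnIntervals.

(** * Limits and derivatives of complex-valued functions of a real variable *)

Section ComplexFunctions.
Variable R : realType.
Local Notation C := R[i].
Local Notation Re := (@complex.Re R).
Local Notation Im := (@complex.Im R).
Implicit Types (z w : C) (f g df dg : R -> C) (t : R).

Lemma complex_eq z w : Re z = Re w -> Im z = Im w -> z = w.
Proof. by case: z w => [a b] [c d] /= -> ->. Qed.

Lemma ReD z w : Re (z + w) = Re z + Re w. Proof. by case: z w => ? ? []. Qed.
Lemma ImD z w : Im (z + w) = Im z + Im w. Proof. by case: z w => ? ? []. Qed.
Lemma ReN z : Re (- z) = - Re z. Proof. by case: z. Qed.
Lemma ImN z : Im (- z) = - Im z. Proof. by case: z. Qed.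
Lemma ReM z w : Re (z * w) = Re z * Re w - Im z * Im w.
Proof. by case: z w => ? ? []. Qed.
Lemma ImM z w : Im (z * w) = Re z * Im w + Im z * Re w.
Proof. by case: z w => ? ? []. Qed.
Definition sqnorm z := Re z ^+ 2 + Im z ^+ 2.
Lemma ReV z : Re z^-1 = Re z / sqnorm z. Proof. by case: z. Qed.
Lemma ImV z : Im z^-1 = - (Im z / sqnorm z).
Proof. by case: z. Qed.

Lemma sqnorm_neq0 z : z != 0 -> sqnorm z != 0.
Proof.
move=> z0; rewrite /sqnorm paddr_eq0 ?sqr_ge0// !sqrf_eq0.
by apply: contra z0 => /andP[/eqP a /eqP b]; apply/eqP; exact: complex_eq.
Qed.

(** Convergence is componentwise, in accordance with [cderive], [cintegral] and [clim_left]. *)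
Definition ccvg (G : set_system R) f z :=
  Re (f t) @[t --> G] --> Re z /\ Im (f t) @[t --> G] --> Im z.

Lemma ccvg_cst (G : set_system R) {FG : Filter G} z : ccvg G (fun=> z) z.
Proof. by split; exact: cvg_cst. Qed.

Lemma ccvgD (G : set_system R) {FG : Filter G} f g z w :
  ccvg G f z -> ccvg G g w -> ccvg G (fun t => f t + g t) (z + w).
Proof.
move=> [f1 f2] [g1 g2]; split.
  by under eq_fun do rewrite ReD; rewrite ReD; exact: cvgD.
by under eq_fun do rewrite ImD; rewrite ImD; exact: cvgD.
Qed.

Lemma ccvgN (G : set_system R) {FG : Filter G} f z :
  ccvg G f z -> ccvg G (fun t => - f t) (- z).
Proof.
move=> [f1 f2]; split.
  by under eq_fun do rewrite ReN; rewrite ReN; exact: cvgN.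
by under eq_fun do rewrite ImN; rewrite ImN; exact: cvgN.
Qed.

Lemma ccvgM (G : set_system R) {FG : Filter G} f g z w :
  ccvg G f z -> ccvg G g w -> ccvg G (fun t => f t * g t) (z * w).
Proof.
move=> [f1 f2] [g1 g2]; split.
  by under eq_fun do rewrite ReM; rewrite ReM; apply: cvgB; apply: cvgM.
by under eq_fun do rewrite ImM; rewrite ImM; apply: cvgD; apply: cvgM.
Qed.

Lemma ccvg_sqnorm (G : set_system R) {FG : Filter G} f z :
  ccvg G f z -> sqnorm (f t) @[t --> G] --> sqnorm z.
Proof.
move=> [f1 f2]; rewrite /sqnorm !expr2.
by under eq_fun do rewrite !expr2; apply: cvgD; [exact: (cvgM f1 f1)|exact: (cvgM f2 f2)].
Qed.

Lemma ccvgV (G : set_system R) {FG : Filter G} f z : z != 0 ->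
  ccvg G f z -> ccvg G (fun t => (f t)^-1) z^-1.
Proof.
move=> /sqnorm_neq0 z0 fz; have nz : sqnorm (f t) @[t --> G] --> sqnorm z by exact: ccvg_sqnorm.
case: fz => f1 f2; split.
  by under eq_fun do rewrite ReV; rewrite ReV; exact: (cvgM f1 (cvgV z0 nz)).
under eq_fun do rewrite ImV; rewrite ImV; apply: cvgN.
exact: (cvgM f2 (cvgV z0 nz)).
Qed.

(** [df] gives the derivative of [f] at [t] only, but is continuous there as a function; when this
    holds at every point of an interval, [f] is of class C^1 on it. *)
Definition C1_at f df t :=
  [/\ is_derive t 1 (fun t => Re (f t)) (Re (df t)),
      is_derive t 1 (fun t => Im (f t)) (Im (df t)) & ccvg (nbhs t) df (df t)].

Lemma C1_at_cvg f df t : C1_at f df t -> ccvg (nbhs t) f (f t).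
Proof.
by move=> [[d1 _] [d2 _] _]; split;
  apply/differentiable_continuous/derivable1_diffP.
Qed.

Lemma C1_at_cst z t : C1_at (fun=> z) (fun=> 0) t.
Proof. by split; [exact: is_derive_cst|exact: is_derive_cst|exact: ccvg_cst]. Qed.

Lemma C1_atD f df g dg t : C1_at f df t -> C1_at g dg t ->
  C1_at (fun t => f t + g t) (fun t => df t + dg t) t.
Proof.
move=> [f1 f2 cf] [g1 g2 cg]; split; last exact: ccvgD.
  by under eq_fun do rewrite ReD; rewrite ReD; exact: is_deriveD.
by under eq_fun do rewrite ImD; rewrite ImD; exact: is_deriveD.
Qed.

Lemma C1_atM f df g dg t : C1_at f df t -> C1_at g dg t ->
  C1_at (fun t => f t * g t) (fun t => df t * g t + f t * dg t) t.
Proof.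
move=> /[dup]/C1_at_cvg cf [f1 f2 cdf] /[dup]/C1_at_cvg cg [g1 g2 cdg]; split.
- under eq_fun do rewrite ReM.
  apply: (is_derive_eq (is_deriveB (is_deriveM f1 g1) (is_deriveM f2 g2))).
  by rewrite ReD !ReM /GRing.scale /=; ring.
- under eq_fun do rewrite ImM.
  apply: (is_derive_eq (is_deriveD (is_deriveM f1 g2) (is_deriveM f2 g1))).
  by rewrite ImD !ImM /GRing.scale /=; ring.
- by apply: ccvgD; apply: ccvgM.
Qed.

Lemma C1_atV f df t : f t != 0 -> C1_at f df t ->
  C1_at (fun t => (f t)^-1) (fun t => - df t * ((f t)^-1 * (f t)^-1)) t.
Proof.
move=> f0 /[dup]/C1_at_cvg cf [f1 f2 cdf]; have n0 := sqnorm_neq0 f0.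
have dn : is_derive t 1 (fun s => sqnorm (f s))
    (2 * (Re (f t) * Re (df t) + Im (f t) * Im (df t))).
  rewrite /sqnorm; under eq_fun do rewrite !expr2.
  apply: (is_derive_eq (is_deriveD (is_deriveM f1 f1) (is_deriveM f2 f2))).
  by rewrite /GRing.scale /=; ring.
have dV := @is_deriveV R (fun s => sqnorm (f s)) _ _ _ n0 dn.
split.
- under eq_fun do rewrite ReV.
  apply: (is_derive_eq (is_deriveM f1 dV)).
  rewrite ReM !ReN !ImN !ReM !ImM !ReV !ImV /GRing.scale /= -!expr2 /sqnorm.
  by field; exact: n0.
- under eq_fun do rewrite ImV.
  apply: (is_derive_eq (is_deriveN (is_deriveM f2 dV))).
  rewrite ImM !ReN !ImN !ReM !ImM !ReV !ImV /GRing.scale /= -!expr2 /sqnorm.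
  by field; exact: n0.
- by apply: ccvgM; [exact: ccvgN|apply: ccvgM; exact: ccvgV].
Qed.

End ComplexFunctions.

(** Polynomials are built from constants and coordinates by sums and products. The class [S] will be
    that of C^1 functions, and that of functions continuous from the left at 1. *)
Lemma hev_closed (K : fieldType) (N : nat) (T : Type) (S : (T -> K) -> Prop)
    (l : T -> 'rV[K]_N.+1) (F : hpoly K N) :
    (forall a, S (fun=> a)) ->
    (forall f g, S f -> S g -> S (fun t => f t + g t)) ->
    (forall f g, S f -> S g -> S (fun t => f t * g t)) ->
    (forall k, S (fun t => l t ord0 k)) ->
  S (fun t => hev F (l t)).
Proof.
move=> Sc SD SM Sl.
have SX f k : S f -> S (fun t => f t ^+ k).
  move=> Sf; elim: k => [|k IH]; first exact: Sc.
  by under eq_fun do rewrite exprS; exact: SM.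
have Sprod I (s : seq I) (f : I -> T -> K) : (forall i, S (f i)) ->
    S (fun t => \prod_(i <- s) f i t).
  move=> Sf; elim: s => [|i s IH].
    by under eq_fun do rewrite big_nil; exact: Sc.
  by under eq_fun do rewrite big_cons; exact: SM.
rewrite /hev; under eq_fun do rewrite mevalE.
elim: (msupp F : seq _) => [|m s IH].
  by under eq_fun do rewrite big_nil; exact: Sc.
under eq_fun do rewrite big_cons; apply: SD => //.
by apply: SM => //; apply: Sprod => k; exact: SX.
Qed.

(** * Integrals of logarithmic derivatives and gluing over an interval *)

Section LogarithmicIntegrals.
Variable R : realType.
Local Notation C := R[i].
Local Notation Re := (@complex.Re R).
Local Notation Im := (@complex.Im R).
Local Notation mu := (@lebesgue_measure R).
Implicit Types (z : C) (phi w dw f : R -> C) (t a b c d : R).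

Definition cintegrable a b f :=
  mu.-integrable `[a, b] (EFin \o (fun t => Re (f t))) /\
  mu.-integrable `[a, b] (EFin \o (fun t => Im (f t))).

Definition log_derive phi t := cderive phi t / phi t.

Lemma cintegral_cat a b c f : a <= b -> b <= c ->
    cintegrable a b f -> cintegrable b c f ->
  cintegrable a c f /\ cintegral a c f = cintegral a b f + cintegral b c f.
Proof.
move=> ab bc [r1 i1] [r2 i2]; have [r3 rE] := integral_cat ab bc r1 r2.
have [i3 iE] := integral_cat ab bc i1 i2.
by split=> //; rewrite /cintegral rE iE.
Qed.

Lemma cintegral_congr_oo a b f g : {in `]a, b[, f =1 g} ->
  cintegrable a b f -> cintegrable a b g /\ cintegral a b g = cintegral a b f.
Proof.
move=> fg [r1 i1].
have [|r2 rE] := @integral_congr_oo _ _ _ _ (fun t => Re (g t)) _ r1.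
  by move=> t /fg ->.
have [|i2 iE] := @integral_congr_oo _ _ _ _ (fun t => Im (g t)) _ i1.
  by move=> t /fg ->.
by split=> //; rewrite /cintegral rE iE.
Qed.

Lemma sqnorm_gt0 z : 0 < Re z -> 0 < sqnorm z.
Proof. by move=> z0; rewrite ltr_pwDl ?exprn_gt0// sqr_ge0. Qed.

Lemma Re_gt0_neq0 z : 0 < Re z -> z != 0.
Proof. by apply: contraTneq => -> /=; rewrite ltxx. Qed.

Lemma ccvg_clog (G : set_system R) {FG : Filter G} f z : 0 < Re z ->
  ccvg G f z -> ccvg G (fun t => clog (f t)) (clog z).
Proof.
move=> z0 fz; have nz : sqnorm (f t) @[t --> G] --> sqnorm z by exact: ccvg_sqnorm.
case: fz => f1 f2; split => /=.
  have ln_cvg : ln (sqnorm (f t)) @[t --> G] --> ln (sqnorm z).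
    by apply: continuous_cvg => //; apply: continuous_ln; exact: sqnorm_gt0.
  exact: (cvgMr_tmp ln_cvg).
have : Im (f t) / Re (f t) @[t --> G] --> Im z / Re z.
  by apply: cvgM => //; apply: cvgV => //; rewrite gt_eqF.
by apply: continuous_cvg; exact: continuous_atan.
Qed.

Lemma clog_derive w dw t : C1_at w dw t -> 0 < Re (w t) ->
  is_derive t 1 (fun s => Re (clog (w s))) (Re (dw t / w t)) /\
  is_derive t 1 (fun s => Im (clog (w s))) (Im (dw t / w t)).
Proof.
move=> [d1 d2 _] w0; have n0 := sqnorm_gt0 w0.
have x0 : Re (w t) != 0 by rewrite gt_eqF.
have nE : sqnorm (w t) = Re (w t) ^+ 2 + Im (w t) ^+ 2 by [].
have nn : Re (w t) ^+ 2 + Im (w t) ^+ 2 != 0 by rewrite -nE gt_eqF.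
rewrite ReM ImM ReV ImV nE; split => /=.
  have dn : is_derive t 1 (fun s => sqnorm (w s))
      (2 * (Re (w t) * Re (dw t) + Im (w t) * Im (dw t))).
    rewrite /sqnorm; under eq_fun do rewrite !expr2.
    apply: (is_derive_eq (is_deriveD (is_deriveM d1 d1) (is_deriveM d2 d2))).
    by rewrite /GRing.scale /=; ring.
  have dl := @is_derive1_comp R _ (fun s => sqnorm (w s)) _ _ _ (is_derive1_ln n0) dn.
  apply: (is_derive_eq (is_deriveM dl (is_derive_cst (2^-1 : R) t 1))).
  by rewrite /GRing.scale /= nE; field.
have dV := @is_deriveV R (fun s => Re (w s)) _ _ _ x0 d1.
have dq : is_derive t 1 (fun s => Im (w s) * (Re (w s))^-1) _ := is_deriveM d2 dV.
have da := @is_derive1_comp R _ _ _ _ _ (is_derive1_atan _) dq.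
apply: (is_derive_eq da); rewrite /GRing.scale /=.
have n1 : 1 + (Im (w t) * (Re (w t))^-1) ^+ 2 != 0.
  by rewrite gt_eqF// ltr_pwDl// sqr_ge0.
move: n1 nn x0; move: (Re (w t)) (Im (w t)) (Re (dw t)) (Im (dw t)).
by move=> x y dx dy n1 nn x0; field; rewrite nn x0.
Qed.

(** The constant [z] cancels in [phi' / phi], and [clog (w t)] is a primitive of [dw / w]. The
    derivatives of [w] are two-sided at [a] and [b] as well, whereas [phi] agrees with [z * w] only
    on [[a, b]]. *)
Lemma dlog_integral_C1 a b phi w dw z : a <= b -> z != 0 ->
    (forall t, a <= t <= b ->
       [/\ C1_at w dw t, 0 < Re (w t) & phi t = z * w t]) ->
  cintegrable a b (log_derive phi) /\
  dlog_integral a b phi = clog (w b) - clog (w a).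
Proof.
rewrite le_eqVlt => /predU1P[<- z0 H|ab z0 H].
  split; first by split; exact: integrable_point.
  by rewrite subrr /dlog_integral /cintegral set_itv1 !Rintegral_set1.
pose q t := dw t / w t.
have qc t : a <= t <= b -> ccvg (nbhs t) q (q t).
  move=> /H[/[dup]/C1_at_cvg cw [_ _ cdw] w0 _].
  by apply: ccvgM => //; apply: ccvgV => //; exact: Re_gt0_neq0.
have [|r1 rE] := @FTC_C1 R a b (fun t => Re (q t)) (fun t => Re (clog (w t))) ab.
  move=> t tab; have [cw w0 _] := H t tab.
  by split; [exact: (clog_derive cw w0).1|exact: (qc t tab).1].
have [|i1 iE] := @FTC_C1 R a b (fun t => Im (q t)) (fun t => Im (clog (w t))) ab.
  move=> t tab; have [cw w0 _] := H t tab.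
  by split; [exact: (clog_derive cw w0).2|exact: (qc t tab).2].
(* Inside the interval [phi] equals [z * w] in a neighbourhood of [t], so its derivative there is
   [z * dw t]; the endpoints do not affect the integral. *)
have [||ci cE] := @cintegral_congr_oo a b q (log_derive phi); [|by []|].
  move=> t; rewrite in_itv/= => /andP[at_ tb].
  have tab : a <= t <= b by rewrite !ltW.
  have [cw w0 pE] := H t tab.
  have E : \forall s \near t, z * w s = phi s.
    have tI : t \in `]a, b[ by rewrite in_itv/= at_.
    near=> s; have [|_ _ ->//] := H s.
    have : s \in `]a, b[ by near: s; exact: near_in_itvoo.
    by rewrite in_itv/= => /andP[/ltW -> /ltW ->].
  have [d1 d2 _] := C1_atM (C1_at_cst z t) cw.
  have D1 : is_derive t 1 (fun s => Re (phi s)) (Re (0 * w t + z * dw t)).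
    by apply: near_eq_is_derive d1; near=> s; congr (Re _); near: s.
  have D2 : is_derive t 1 (fun s => Im (phi s)) (Im (0 * w t + z * dw t)).
    by apply: near_eq_is_derive d2; near=> s; congr (Im _); near: s.
  rewrite /log_derive /q pE.
  have -> : cderive phi t = z * dw t.
    rewrite /cderive !derive1E; case: D1 D2 => _ e1 [_ e2].
    by rewrite mul0r add0r in e1 e2; apply: complex_eq.
  have w0' := Re_gt0_neq0 w0.
  by field; rewrite ?w0' ?z0.
split=> //; rewrite /dlog_integral -/(log_derive phi) cE.
by rewrite /cintegral rE iE; apply: complex_eq; rewrite ?ReD ?ImD ?ReN ?ImN.
Unshelve. all: by end_near. Qed.

(** Compactness of [[a, b]] through the supremum of the [t] with [S a t]: the local hypothesis at
    this supremum carries [S] up to it and beyond it, unless it is [b]. *)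
Lemma interval_induction (S : R -> R -> Prop) a b : a <= b ->
    (forall x y v : R, x <= y -> y <= v -> a <= x -> v <= b ->
       S x y -> S y v -> S x v) ->
    (forall t, a <= t <= b -> exists2 e, 0 < e & forall x y,
       a <= x <= t -> t <= y <= b -> t - e < x -> y < t + e -> S x y) ->
  S a b.
Proof.
move=> ab Strans Sloc.
pose A := [set t | a <= t <= b /\ S a t].
have Aa : A a.
  split; first by rewrite lexx.
  have [|e e0 H] := Sloc a; first by rewrite lexx.
  by apply: H; rewrite ?lexx ?ltrBlDr ?ltrDl.
have hsA : has_sup A by split; [exists a|exists b => t [/andP[]]].
have as_ : a <= sup A by apply: sup_upper_bound.
have sb : sup A <= b by apply: ge_sup; [exists a|move=> t [/andP[]]].
have [|e e0 H] := Sloc (sup A); first by rewrite as_.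
have [x [/andP[ax xb] Sax] xs] := sup_adherent e0 hsA.
have xs' : x <= sup A by apply: sup_upper_bound => //; split=> //; rewrite ax.
(* A point strictly beyond the supremum and still within [e] of it, unless [b] comes first. *)
pose y := Num.min b (sup A + e / 2).
have e2 : 0 < e / 2 by rewrite divr_gt0.
have sy : sup A <= y by rewrite le_min sb lerDl ltW.
have yb : y <= b by rewrite ge_min lexx.
have Say : S a y.
  apply: (Strans a x y) => //; first exact: le_trans sy.
  apply: H => //; [by rewrite ax|by rewrite sy|].
  by rewrite gt_min ltrD2l gtr_pMr// invf_lt1// ltr1n orbT.
have : y <= sup A.
  by apply: sup_upper_bound => //; split=> //; rewrite yb (le_trans as_).
move: Say; rewrite /y; case: (leP b (sup A + e / 2)) => [//|_ _].
by rewrite gerDl leNgt e2.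
Qed.

End LogarithmicIntegrals.

(** * Logarithms along a path, up to its endpoint *)

Section LogarithmAlongPath.
Variables (R : realType) (N : nat).
Local Notation C := R[i].
Local Notation Re := (@complex.Re R).
Local Notation Im := (@complex.Im R).
Implicit Types (l psi : R -> 'rV[C]_N.+1) (phi f : R -> C) (z : C).
Implicit Types (a b c d t : R).

Definition coords_C1 l a b := forall k,
  C1_on a b (fun t => Re (l t ord0 k)) /\
  C1_on a b (fun t => Im (l t ord0 k)).

(** The coordinates of a C^1 piece extend to C^1 functions on the whole line, which provides
    two-sided derivatives also at the ends [c] and [d]. *)
Lemma C1_on_lift c d l :
    coords_C1 l c d ->
  exists psi (dpsi : 'I_N.+1 -> R -> C),
    (forall k t, C1_at (fun t => psi t ord0 k) (dpsi k) t) /\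
    (forall t, c <= t <= d -> l t = psi t).
Proof.
move=> H.
have /choice[p hp] : forall k, exists p : R -> R,
    [/\ forall t, derivable p t 1, continuous (derive1 p) &
        forall t, c <= t <= d -> Re (l t ord0 k) = p t].
  by move=> k; case: (H k).
have /choice[q hq] : forall k, exists q : R -> R,
    [/\ forall t, derivable q t 1, continuous (derive1 q) &
        forall t, c <= t <= d -> Im (l t ord0 k) = q t].
  by move=> k; case: (H k).
exists (fun t => \row_k Complex (p k t) (q k t)).
exists (fun k t => Complex (derive1 (p k) t) (derive1 (q k) t)); split.
  move=> k t; have [dp cp _] := hp k; have [dq cq _] := hq k; split.
  - under eq_fun do rewrite mxE /=; rewrite /= derive1E.
    by apply: DeriveDef => //; exact: dp.
  - under eq_fun do rewrite mxE /=; rewrite /= derive1E.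
    by apply: DeriveDef => //; exact: dq.
  - by split; [exact: cp|exact: cq].
move=> t tcd; apply/rowP => k; rewrite mxE.
have [_ _ /(_ t tcd) e1] := hp k; have [_ _ /(_ t tcd) e2] := hq k.
exact: complex_eq.
Qed.

Lemma hev_C1 psi (dpsi : 'I_N.+1 -> R -> C) (F : hpoly C N) :
    (forall k t, C1_at (fun t => psi t ord0 k) (dpsi k) t) ->
  exists df, forall t, C1_at (fun t => hev F (psi t)) df t.
Proof.
move=> H.
pose S f := exists df, forall t, C1_at f df t.
apply: (hev_closed (S := S)).
- by move=> z; exists (fun=> 0) => t; exact: C1_at_cst.
- by move=> f g [df hf] [dg hg]; eexists => t; exact: C1_atD.
- by move=> f g [df hf] [dg hg]; eexists => t; exact: C1_atM.
- by move=> k; exists (dpsi k).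
Qed.

(** A breakpoint of the subdivision lies in two different pieces, so the piece reaching to the right
    of [t] and the one reaching to its left are found separately. *)
Lemma subdivision_piece (x0 : R) (P : R -> R -> Prop) c (s : seq R) t :
    path <%R c s ->
    (forall j, (j < size s)%N -> P (nth x0 (c :: s) j) (nth x0 s j)) ->
  (c <= t < last c s -> exists a b, [/\ a <= t, t < b & P a b]) /\
  (c < t <= last c s -> exists a b, [/\ a < t, t <= b & P a b]).
Proof.
elim: s c => [|d s IH] c /=.
  move=> _ _; split => /andP[ct tc].
    by move: (le_lt_trans ct tc); rewrite ltxx.
  by move: (lt_le_trans ct tc); rewrite ltxx.
move=> /andP[cd ps] HP; have P0 := HP 0%N isT.
have [H1 H2] := IH d ps (fun j => HP j.+1); split => /andP[ct tl].
  have [dt|td] := leP d t; first by apply: H1; rewrite dt.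
  by exists c, d.
have [dt|td] := ltP d t; first by apply: H2; rewrite dt.
by exists c, d.
Qed.

Lemma ccvg_neq0 (G : set_system R) {FG : Filter G} f z : z != 0 ->
  ccvg G f z -> \forall t \near G, f t != 0.
Proof.
move=> /sqnorm_neq0 z0 fz.
have nz : sqnorm (f t) @[t --> G] --> sqnorm z by exact: ccvg_sqnorm.
have n0 : 0 < sqnorm z by rewrite lt_neqAle eq_sym z0 /sqnorm addr_ge0 ?sqr_ge0.
apply: filterS (cvgr_gt _ nz _ n0) => t.
by apply: contraTneq => ->; rewrite /sqnorm /= expr0n /= addr0 ltxx.
Qed.

Lemma ccvg_Re_gt0 (G : set_system R) {FG : Filter G} f z : 0 < Re z ->
  ccvg G f z -> \forall t \near G, 0 < Re (f t).
Proof. by move=> z0 [fz _]; exact: (cvgr_gt _ fz). Qed.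

(** The half-plane conditions at the two ends make [clogK] applicable there. Primitives with a
    common [z] glue additively. *)
Definition clog_primitive phi z a b :=
  [/\ cintegrable a b (log_derive phi),
      dlog_integral a b phi = clog (phi b / z) - clog (phi a / z),
      0 < Re (phi a / z) & 0 < Re (phi b / z)].

Lemma clog_primitive_cat phi z a b c : a <= b -> b <= c ->
  clog_primitive phi z a b -> clog_primitive phi z b c ->
  clog_primitive phi z a c.
Proof.
move=> ab bc [i1 e1 a1 b1] [i2 e2 _ c2].
have [i3 e3] := cintegral_cat ab bc i1 i2; split=> //.
rewrite /dlog_integral in e1 e2 *; rewrite -/(log_derive phi) in e1 e2 *.
by rewrite e3 e1 e2 addrC addrA subrK.
Qed.

(** The multiplicative form does not mention [z], so pieces normalised by different constants can be
    glued. *)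
Definition exp_primitive phi a b :=
  cintegrable a b (log_derive phi) /\
  cexp (dlog_integral a b phi) * phi a = phi b.

Lemma exp_primitive_cat phi a b c : a <= b -> b <= c ->
  exp_primitive phi a b -> exp_primitive phi b c -> exp_primitive phi a c.
Proof.
move=> ab bc [i1 e1] [i2 e2].
have [i3 e3] := cintegral_cat ab bc i1 i2; split=> //.
rewrite /dlog_integral in e1 e2 *; rewrite -/(log_derive phi) in e1 e2 *.
by rewrite e3 addrC cexpD -mulrA e1.
Qed.

Lemma clog_exp_primitive phi z a b :
  clog_primitive phi z a b -> exp_primitive phi a b.
Proof.
move=> [i1 e1 a1 b1]; split=> //; rewrite e1 cexpD cexpN !clogK//.
have := Re_gt0_neq0 a1; have := Re_gt0_neq0 b1.
rewrite !mulf_eq0 !invr_eq0 !negb_or => /andP[pb z0] /andP[pa _].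
by field; rewrite pa z0.
Qed.

Variables (l : R -> 'rV[C]_N.+1) (phi : R -> C).
Hypothesis l_cont : Defs.coord_continuous (`[0, 1] : set R) l.
Hypothesis l_C1 : forall b, 0 <= b < 1 -> piecewise_C1 0 b l.
(** The fraction [h] may change with [t]; around [t] it represents [phi]. The endpoint 1 is
    included, although the lift is piecewise C^1 only before it. *)
Hypothesis phi_rational : forall t, 0 <= t <= 1 ->
  exists h : rfrac C N, [/\ hev h.1 (l t) != 0, hev h.2 (l t) != 0 &
    forall s, 0 <= s <= 1 -> hev h.2 (l s) != 0 -> phi s = rf_at h (l s)].

(** On the piece, [phi / z] is a fraction in C^1 coordinates; by continuity it stays defined, with
    positive real part, close to [t]. The bounds [Num.max 0 c] and [Num.min 1 d] cut the piece down
    to the domain of the path. *)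
Lemma clog_primitive_segment c d t z :
    coords_C1 l c d ->
    c <= t <= d -> 0 <= t <= 1 -> 0 < Re (phi t / z) ->
  exists2 e, 0 < e & forall a b, Num.max 0 c <= a -> a <= b ->
    b <= Num.min 1 d -> t - e < a -> b < t + e -> clog_primitive phi z a b.
Proof.
move=> /C1_on_lift[psi [dpsi [cpsi lpsi]]] tcd t01 phit.
have z0 : z != 0.
  by apply: contraTneq phit => ->; rewrite invr0 mulr0 ltxx.
have [h [_ h2 hphi]] := phi_rational t01.
have [d1 c1] := hev_C1 h.1 cpsi; have [d2 c2] := hev_C1 h.2 cpsi.
pose u2 s := hev h.2 (psi s).
pose w s := hev h.1 (psi s) * (u2 s)^-1 * z^-1.
(* The derivative is written in the form given by the rules for products and inverses; the last term
   comes from the constant factor [z^-1]. *)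
pose dw s := (d1 s * (u2 s)^-1 +
  hev h.1 (psi s) * (- d2 s * ((u2 s)^-1 * (u2 s)^-1))) * z^-1 +
  hev h.1 (psi s) * (u2 s)^-1 * 0.
have cw s : u2 s != 0 -> C1_at w dw s.
  by move=> u0; do ?[apply: C1_atM] => //; [exact: C1_atV|exact: C1_at_cst].
have u2t : u2 t != 0 by rewrite /u2 -lpsi.
have wt : w t = phi t / z.
  by rewrite (hphi t t01 h2) /w /u2 -(lpsi t tcd).
have near_u2 : \forall s \near t, u2 s != 0.
  by apply: (@ccvg_neq0 _ (nbhs_filter t) u2 (u2 t)) => //; exact: C1_at_cvg (c2 t).
have near_w : \forall s \near t, 0 < Re (w s).
  apply: (@ccvg_Re_gt0 _ (nbhs_filter t) w (w t)); first by rewrite wt.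
  exact: C1_at_cvg (cw t u2t).
have /nbhs_ballP[e e0 He] : \forall s \near t, u2 s != 0 /\ 0 < Re (w s).
  by near=> s; split; near: s.
exists e => // a b; rewrite ge_max le_min => /andP[a0 ca] ab /andP[b1 bd] ta bt.
have H s : a <= s <= b -> [/\ C1_at w dw s, 0 < Re (w s) & phi s = z * w s].
  move=> /andP[as_ sb].
  have [|u0 w0] := He s.
    by rewrite /ball /= ltr_distlC (lt_le_trans ta)//= (le_lt_trans sb).
  have ls : l s = psi s by apply: lpsi; rewrite (le_trans ca)//= (le_trans sb).
  split=> //; first exact: cw.
  rewrite hphi ?ls//; last by rewrite (le_trans a0)//= (le_trans sb).
  by rewrite /w mulrCA divff// mulr1.
have [i1 e1] := dlog_integral_C1 ab z0 H.
have pw s : a <= s <= b -> phi s / z = w s.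
  by move=> /H[_ _ ->]; rewrite mulrC mulKf.
have [[_ wa _] [_ wb _]] : [/\ C1_at w dw a, 0 < Re (w a) & phi a = z * w a] /\
    [/\ C1_at w dw b, 0 < Re (w b) & phi b = z * w b].
  by split; apply: H; rewrite ?lexx ?ab.
by split; rewrite ?(pw a) ?(pw b) ?lexx ?ab.
Unshelve. all: by end_near. Qed.

Lemma clog_primitive_local t z : 0 <= t < 1 -> 0 < Re (phi t / z) ->
  exists2 e, 0 < e & forall a b, 0 <= a <= t -> t <= b < 1 ->
    t - e < a -> b < t + e -> clog_primitive phi z a b.
Proof.
move=> /andP[t0 t1] phit.
(* The lift is piecewise C^1 on [[0, b]] for [b < 1]; the midpoint of [t] and 1 leaves room to the
   right of [t]. *)
pose b := (t + 1) / 2; have tb : t < b by rewrite /b; lra.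
have b1 : b < 1 by rewrite /b; lra.
have [s [ps sb pieces]] : piecewise_C1 0 b l.
  by apply: l_C1; rewrite b1 (le_trans t0)// ltW.
have [Hr Hl] := @subdivision_piece 0 (coords_C1 l) 0 s t ps (fun j jn k => pieces j k jn).
have t01 : 0 <= t <= 1 by rewrite t0 ltW.
have [|c [d [ct td Hcd]]] := Hr; first by rewrite t0 sb.
have ctd : c <= t <= d by rewrite ct ltW.
have [e e0 He] := clog_primitive_segment Hcd ctd t01 phit.
(* A point less than [d - t] to the right of [t] stays in the piece [[c, d]]. *)
pose e1 := Num.min e (d - t).
have e10 : 0 < e1 by rewrite lt_min e0 subr_gt0.
have right x : t <= x < 1 -> x < t + e1 -> clog_primitive phi z t x.
  move=> /andP[tx x1]; rewrite -ltrBlDl lt_min => /andP[xe xd].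
  apply: He => //.
  - by rewrite ge_max t0 ct.
  - by rewrite le_min (ltW x1) ltW//; lra.
  - lra.
  - lra.
(* At [t = 0] no piece lies to the left, and [0 <= a <= t] forces [a = t]. *)
have [t00|tn0] := eqVneq t 0.
  exists e1 => // a x /andP[a0 at_] tx _ xe.
  have -> : a = t by apply: le_anti; rewrite at_ t00.
  exact: right.
have [|c' [d' [ct' td' Hcd']]] := Hl.
  by rewrite lt_neqAle eq_sym tn0 t0 sb ltW.
have ctd' : c' <= t <= d' by rewrite td' ltW.
have [e' e'0 He'] := clog_primitive_segment Hcd' ctd' t01 phit.
exists (Num.min e1 (Num.min e' (t - c'))).
  by rewrite lt_min e10 lt_min e'0 subr_gt0.
move=> a x /andP[a0 at_] /[dup] tx1 /andP[tx x1] ta xt.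
have : t - a < Num.min e1 (Num.min e' (t - c')) by lra.
have : x - t < Num.min e1 (Num.min e' (t - c')) by lra.
rewrite ![_ < Num.min e1 _]lt_min ![_ < Num.min e' _]lt_min.
move=> /and3P[xe1 xe' xc'] /and3P[ae1 ae' ac'].
apply: (clog_primitive_cat at_ tx).
  apply: He' => //.
  - by rewrite ge_max a0 ltW//; lra.
  - by rewrite le_min (ltW t1) td'.
  - lra.
  - lra.
by apply: right => //; lra.
Qed.

Lemma phi_neq0 t : 0 <= t <= 1 -> phi t != 0.
Proof.
move=> t01; have [h [h1 h2 hphi]] := phi_rational t01.
by rewrite hphi// mulf_neq0// invr_eq0.
Qed.

(** Around each [t] the choice [z = phi t] gives [phi t / z = 1], which lies in the half-plane. As
    [z] varies with [t], the pieces are glued in exponential form. *)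
Lemma exp_primitive_0 b : 0 <= b < 1 -> exp_primitive phi 0 b.
Proof.
move=> /andP[b0 b1]; apply: interval_induction => // [x y v xy yv _ _|t /andP[t0 tb]].
  exact: exp_primitive_cat.
have t01 : 0 <= t < 1 by rewrite t0 (le_lt_trans tb).
have [|e e0 He] := clog_primitive_local (z := phi t) t01.
  by rewrite divff ?ltr01// phi_neq0// t0 ltW// (le_lt_trans tb).
exists e => // x y xt /andP[ty yb] tx ye.
apply: clog_exp_primitive; apply: He => //.
by rewrite ty (le_lt_trans yb).
Qed.

(** Near 1 a single fraction in the coordinates represents [phi], and continuity of the lift from
    the left is enough. *)
Lemma phi_cvg1 : ccvg 1^'- phi (phi 1).
Proof.
have i01 : 0 <= (1 : R) <= 1 by rewrite ler01 lexx.
have [h [h1 h2 hphi]] := phi_rational i01.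
have lc F : ccvg 1^'- (fun t => hev F (l t)) (hev F (l 1)).
  pose S f := ccvg 1^'- f (f 1).
  apply: (hev_closed (S := S)) => [a|f g|f g|k]; [exact: ccvg_cst
    |exact: ccvgD|exact: ccvgM|].
  have [cr ci] := l_cont k.
  have [_ _ cr1] := (continuous_within_itvP _ ltr01).1 cr.
  by have [_ _ ci1] := (continuous_within_itvP _ ltr01).1 ci.
have [c1 c2] : ccvg 1^'- (fun t => rf_at h (l t)) (rf_at h (l 1)).
  by apply: ccvgM => //; exact: ccvgV.
have E : \forall t \near 1^'-, rf_at h (l t) = phi t.
  have nz2 : \forall t \near 1^'-, hev h.2 (l t) != 0.
    exact: ccvg_neq0 h2 (lc h.2).
  near=> t; rewrite hphi//.
    by apply/andP; split; [near: t; exact: nbhs_left_ge|near: t; exact: nbhs_left_le].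
  by near: t.
have -> : phi 1 = rf_at h (l 1) by exact: hphi.
split.
  by apply: cvg_trans c1; apply: near_eq_cvg; near=> t; congr (Re _); near: t.
by apply: cvg_trans c2; apply: near_eq_cvg; near=> t; congr (Im _); near: t.
Unshelve. all: by end_near. Qed.

(** Close to 1 the single constant [z = phi 1] serves for all [t]. There the integral up to [b] is a
    constant plus [clog (phi b / phi 1)], and the last term tends to [clog 1 = 0]. *)
Lemma cexp_lim_dlog_integral :
  cexp (clim_left 1 (fun b => dlog_integral 0 b phi)) * phi 0 = phi 1.
Proof.
set D := phi 1; have D0 : D != 0 by apply: phi_neq0; rewrite ler01 lexx.
have cD : ccvg 1^'- (fun t => phi t / D) 1.
  rewrite -(divff D0); apply: ccvgM; [exact: phi_cvg1|exact: ccvg_cst].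
have Re1 : 0 < Re 1 by rewrite ltr01.
have [b0 /andP[b00 b01] Hb] : exists2 b0, 0 <= b0 < 1 &
    forall t, b0 <= t < 1 -> 0 < Re (phi t / D).
  have nearRe : \forall t \near 1^'-, 0 < Re (phi t / D).
    exact: ccvg_Re_gt0 Re1 cD.
  have /nbhs_ballP[e /= e0 He] : \forall t \near (1 : R), t < 1 -> 0 < Re (phi t / D).
    exact: nearRe.
  exists (Num.max 0 (1 - e / 2)); first by rewrite le_max lexx gt_max ltr01/=; lra.
  move=> t /andP[]; rewrite ge_max => /andP[t0 te] t1; apply: He => //.
  by rewrite /ball /= ltr_distl; apply/andP; split; lra.
have prim b : b0 <= b < 1 -> clog_primitive phi D b0 b.
  move=> /andP[b0b b1].
  apply: interval_induction => // [x y v xy yv _ _|t /andP[t0 tb]].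
    exact: clog_primitive_cat.
  have tt1 : 0 <= t < 1 by rewrite (le_trans b00)//= (le_lt_trans tb).
  have [|e e0 He] := clog_primitive_local (z := D) tt1.
    by apply: Hb; rewrite t0 (le_lt_trans tb).
  exists e => // x y /andP[bx xt] /andP[ty yb] tx ye; apply: He => //.
    by rewrite xt (le_trans b00).
  by rewrite ty (le_lt_trans yb).
have [i0 e0] : exp_primitive phi 0 b0 by apply: exp_primitive_0; rewrite b00.
(* [J] will be the limit of the integrals. Its exponential is [phi b0 / phi 0] divided by
   [phi b0 / D], that is [D / phi 0]. *)
pose J := dlog_integral 0 b0 phi - clog (phi b0 / D).
have E : \forall b \near 1^'-, J + clog (phi b / D) = dlog_integral 0 b phi.
  near=> b.
  have b0b : b0 <= b by near: b; exact: nbhs_left_ge.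
  have b1 : b < 1 by near: b; exact: nbhs_left_lt.
  have [|i1 e1 _ _] := prim b; first by rewrite b0b.
  have [_ e2] := cintegral_cat b00 b0b i0 i1.
  have -> : dlog_integral 0 b phi =
    dlog_integral 0 b0 phi + dlog_integral b0 b phi := e2.
  by rewrite e1 /J -addrA [- _ + _]addrC.
have [cJ1 cJ2] : ccvg 1^'- (fun b => dlog_integral 0 b phi) J.
  have [c1 c2] : ccvg 1^'- (fun b => J + clog (phi b / D)) (J + 0).
    by apply: ccvgD; [exact: ccvg_cst|rewrite -clog1; exact: ccvg_clog].
  rewrite -[J]addr0; split.
    by apply: cvg_trans c1; apply: near_eq_cvg; near=> b; congr (Re _); near: b.
  by apply: cvg_trans c2; apply: near_eq_cvg; near=> b; congr (Im _); near: b.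
have -> : clim_left 1 (fun b => dlog_integral 0 b phi) = J.
  apply: complex_eq; rewrite /clim_left /=; apply: cvg_lim => //.
rewrite /J cexpD cexpN clogK; last by apply: Hb; rewrite lexx.
rewrite mulrAC e0; have : phi b0 != 0 by apply: phi_neq0; rewrite b00 ltW.
by move=> p0; field; rewrite p0 D0.
Unshelve. all: by end_near. Qed.

End LogarithmAlongPath.

(** * Restriction to a curve *)

Section Restriction.
Variables (K : fieldType) (N : nat).
Implicit Types (v w P : 'rV[K]_N.+1) (Z X Y : set 'rV[K]_N.+1).
Implicit Types (f h : rfrac K N).

Lemma variety_scale Z v w : variety Z -> Z v -> (w == v)%MS -> Z w.
Proof.
move=> hZ Zv wv; have v0 := variety_neq0 hZ Zv.
have [a a0 vE] := eqmx_scale v0 wv.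
have w0 : w != 0 by apply: contra_neq v0 => w0; rewrite vE w0 scaler0.
case: hZ Zv => -[S hS ->] _ _ [_ vS]; split=> // F SF.
by apply/eqP; rewrite -(hev_eq0 (hS F SF) v0 wv) vS.
Qed.

(** [rf_val] takes a value by choice, but any two representatives defined at [v] agree generically,
    hence at [v] after cross multiplication. *)
Lemma rf_valE Z v f h : variety Z -> Z v -> germ Z (ppoint v) f h ->
  rf_val Z f v = rf_at h v.
Proof.
move=> hZ Zv gh; rewrite /rf_val.
case: xgetP => [_ _ [k gk ->]|/(_ (rf_at h v)) []]; last by exists h.
have [[_ rh _ _] [_ rk _ _]] := (gh, gk).
apply/eqP; rewrite eqr_div ?(germ_den gh) ?(germ_den gk)//; apply/eqP.
apply: (gen_eq_eval hZ Zv) => //.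
by apply: (gen_eq_trans hZ (gen_eq_sym (germ_gen hZ gk))); exact: germ_gen gh.
Qed.

Lemma germ_at Z v f h : variety Z -> Z v -> ratfun Z f -> ratfun Z h ->
  rf_eq Z f h -> hev h.2 v != 0 -> germ Z (ppoint v) f h.
Proof.
move=> hZ Zv rf rh e h2; split=> //; apply: nonvanishing h2.
by split; [exact: variety_neq0 Zv|rewrite submx_refl].
Qed.

(** The representative chosen by [rf_restrict] may have a denominator that vanishes at [v], but it
    is equal to [h] as a function on [X], hence on [Y], so [h] represents the restriction at [v]. *)
Lemma germ_restrict X Y v f h : variety X -> variety Y -> Y `<=` X -> Y v ->
    ratfun X f -> hom2 h -> gen_eq X f h -> hev h.2 v != 0 ->
  germ Y (ppoint v) (rf_restrict X Y f) h.
Proof.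
move=> hX hY YX Yv rf hh fh h2.
have rh : ratfun X h by apply: ratfun_hom2 h2 => //; exact: YX.
rewrite /rf_restrict; case: xgetP => [k _ [_ rk fk k2]|/(_ h) []]; last first.
  by split=> //; [exact: gen_rf_eq|exact: nonvanishing h2].
apply: germ_at => //.
- by split=> //; case: rk.
- by split=> //; exact: nonvanishing h2.
- move=> w /YX; apply: gen_rf_eq => //.
  by apply: (gen_eq_trans hX _ fh); apply: gen_eq_sym; exact: rf_eq_gen.
Qed.

(** With exponent 0 only the unit factor remains, so [f] is a unit at some point of [Y]. This serves
    to show that [x_0] and [x_j] are nonzero functions. *)
Lemma ord0_nonzero X Y f : variety X -> prime_divisor X Y ->
  ord_along X Y f 0 -> nzratfun X f.
Proof.
move=> hX [hY YX _] [rf [t [u [_ [h gh h1] e]]]]; split=> //.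
have [ru rh uh h2] := gh; have hh := germ_hom2 gh.
have [v Yv] := nonvanishingP (nonzero_onM hY (conj (hom21 hh) h1)
  (conj (hom22 hh) h2)).2.
rewrite hevM mulf_eq0 negb_or => /andP[h1v h2v].
apply: (unit_at_nonzero hX (YX _ Yv)); first by case: rf.
exists h; split=> //.
have one v' : hev (1 : hpoly K N) v' != 0 by rewrite hev1 oner_neq0.
have r1 : ratfun X (rf_pow t 0).
  by split; [exists 0%N; split; exact: dhomog1|exact: nonvanishing (YX _ Yv) (one v)].
apply: (gen_eq_trans hX (rf_eq_gen hX rf (ratfunM hX r1 ru) e)).
apply: (gen_eq_trans hX _ (germ_gen hX gh)).
by apply: gen_eq_at => // v' _; rewrite rf_atM rf_at_pow expr0z mul1r.
Qed.

End Restriction.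

(** * The integral of dg/g along a path on the curve *)

Section PathIntegral.
Variables (R : realType) (N : nat).
Implicit Types (X Y S : set 'rV[R[i]]_N.+1) (g : rfrac R[i] N).

(** The values of the restricted [g] along [gamma] are locally given by a fraction in the
    coordinates of the lift: before time 1 because the path avoids zeros and poles, at time 1
    because [g] is a unit at [P]. *)
Lemma cexp_path_integral_dlog X (C0 : set ('rV[R[i]]_N.+1)) S g (gamma : R -> 'rV[R[i]]_N.+1) P Q :
    variety X -> variety C0 -> C0 `<=` X -> S `<=` C0 ->
    ratfun X g -> C0 P -> unit_at X P g ->
    (gamma 0 == Q)%MS -> is_path_towards S gamma P ->
    avoids_zeros_and_poles X C0 g gamma ->
  cexp (path_integral_dlog X C0 g gamma) * restricted_val X C0 g Q =
  rf_val X g P.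
Proof.
move=> hX hC CX SC rg CP [hP [hhP ghP hP1 hP2]] gQ [l [lc lC1 gl gS gP]] avoid.
have Cg t : 0 <= t <= 1 -> C0 (gamma t).
  move=> /andP[t0]; rewrite le_eqVlt => /predU1P[->|t1].
    exact: variety_scale gP.
  by apply: SC; apply: gS; rewrite t0.
have lg t : 0 <= t <= 1 -> (l t == gamma t)%MS.
  by move=> /gl; rewrite andbC.
have g0 t : 0 <= t <= 1 -> gamma t != 0 by move=> /Cg; exact: variety_neq0.
have germP t : 0 <= t <= 1 -> hev hP.2 (gamma t) != 0 ->
    germ C0 (ppoint (gamma t)) (rf_restrict X C0 g) hP.
  by move=> t01 ?; apply: germ_restrict => //; exact: Cg.
have P0 := variety_neq0 hC CP.
have i11 : 0 <= (1 : R) <= 1 by rewrite ler01 lexx.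
have i00 : 0 <= (0 : R) <= 1 by rewrite ler01 lexx.
pose phi t := restricted_val X C0 g (gamma t).
have rational t : 0 <= t <= 1 -> exists h : rfrac R[i] N,
    [/\ hev h.1 (l t) != 0, hev h.2 (l t) != 0 & forall s, 0 <= s <= 1 ->
      hev h.2 (l s) != 0 -> phi s = rf_at h (l s)].
  move=> t01.
  have [h [hh h1 h2 gh]] : exists h : rfrac R[i] N, [/\ hom2 h,
      hev h.1 (gamma t) != 0, hev h.2 (gamma t) != 0 &
      forall s, 0 <= s <= 1 -> hev h.2 (gamma s) != 0 ->
        germ C0 (ppoint (gamma s)) (rf_restrict X C0 g) h].
    move: (t01) => /andP[t0]; rewrite le_eqVlt => /predU1P[->|t1].
      exists hP; split=> //.
        by rewrite -(hev_eq0 (hom21 hhP) P0 gP).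
      by rewrite -(hev_eq0 (hom22 hhP) P0 gP).
    have [|h gh h1] := avoid t; first by rewrite t0.
    have hh := germ_hom2 gh; exists h; split=> //.
    - exact: ppoint_nonzero (hom21 hh) h1.
    - exact: germ_den gh.
    - by move=> s s01 hs; case: gh => *; apply: germ_at => //; exact: Cg.
  (* [gamma s] and [l s] are coordinates of one point, so vanishing, and values of fractions of
     degree 0, are transferred to the continuous lift. *)
  have hl F s : hom F -> 0 <= s <= 1 -> (hev F (gamma s) == 0) = (hev F (l s) == 0).
    by move=> hF s01; apply: hev_eq0 => //; [exact: g0|exact: lg].
  exists h; split; rewrite -?hl//; [exact: hom21|exact: hom22|].
  move=> s s01; rewrite -hl//; last exact: hom22.
  move=> /(gh s s01) ghs.
  rewrite /phi /restricted_val (rf_valE hC (Cg s s01) ghs).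
  by apply: rf_at_scale => //; [exact: g0|exact: lg].
have := cexp_lim_dlog_integral lc lC1 rational.
(* At the endpoint [hP] represents both [g] on [X] and its restriction to [C0], which identifies the
   two values. *)
have -> : phi 1 = rf_val X g P.
  have hP2' : hev hP.2 (gamma 1) != 0 by rewrite -(hev_eq0 (hom22 hhP) P0 gP).
  rewrite /phi /restricted_val (rf_valE hC (Cg 1 i11) (germP 1 i11 hP2')).
  rewrite -(rf_at_scale hhP P0 gP); apply/esym/(rf_valE hX (CX _ CP)).
  have XP := CX _ CP; have rhP := ratfun_hom2 XP hhP hP2.
  by apply: germ_at => //; exact: gen_rf_eq.
(* [gamma 0] and [Q] may differ by a scalar factor, so one fraction is evaluated at both. *)
have -> : phi 0 = restricted_val X C0 g Q.
  have [|h gh _] := avoid 0; first by rewrite lexx ltr01.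
  have hh := germ_hom2 gh.
  have CQ : C0 Q.
    by apply: (variety_scale hC (Cg 0 i00)); rewrite andbC.
  have Q0 := variety_neq0 hC CQ.
  have ghQ : germ C0 (ppoint Q) (rf_restrict X C0 g) h.
    case: (gh) => *; apply: germ_at => //.
    by rewrite (hev_eq0 (hom22 hh) Q0 gQ); exact: germ_den gh.
  rewrite /phi /restricted_val (rf_valE hC (Cg 0 i00) gh) (rf_valE hC CQ ghQ).
  by apply/esym/rf_at_scale.
exact.
Qed.

End PathIntegral.

(** * The formula for the refined symbol *)

(** The sign is a power of [cexp (ipi R)] whose exponent is the very integer in the logarithm, not
    merely one of the same parity; the rest follows from the laws of integer exponents. *)
Lemma signed_powers_cexp (R : realType) (n1 n2 n3 m1 m2 m3 : int) (I1 I3 q1 q3 : R[i]) :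
  (-1) ^ (n1 * n3 * m2 - m1 * m3 * n2) *
    ((cexp I1 * q1) ^ n3 / (cexp I3 * q3) ^ n1) ^ m2 =
  cexp (ipi R * (m2 * n1 * n3 - n2 * m1 * m3)%:~R + (m2 * n3)%:~R * I1
        - (m2 * n1)%:~R * I3) * q1 ^ (m2 * n3) * q3 ^ (- (m2 * n1)).
Proof.
rewrite cexpD cexpN cexpD (mulrC (ipi R)) !cexpMz cexp_ipi.
have -> : m2 * n1 * n3 - n2 * m1 * m3 = n1 * n3 * m2 - m1 * m3 * n2 by ring.
rewrite (mulrC m2 n3) (mulrC m2 n1).
move: (cexp I1) (cexp I3) ((-1) ^ _) => E1 E3 e.
rewrite (expfzMl (_ ^ n3)) !expfzMl invfM !expfzMl !exprz_inv !exprz_exp.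
rewrite invr_expz !mulrN.
move: (E1 ^ _) (E3 ^ _) (q1 ^ _) (q3 ^ _) => a b u v.
by ring.
Qed.

Theorem theorem0p7 (R : realType) (N : nat)
  (X : set 'rV[R[i]]_N.+1) (f : 'I_3 -> rfrac R[i] N)
  (r : nat) (C : 'I_r.+1 -> set 'rV[R[i]]_N.+1)
  (n : 'I_3 -> 'I_r.+1 -> int) (x : 'I_r.+1 -> rfrac R[i] N)
  (s : nat) (P : 'I_s -> 'rV[R[i]]_N.+1) (c : 'I_s -> 'I_r.+1)
  (hX : surface_data X f C n x P c)
  (G : 'I_s -> 'I_3 -> rfrac R[i] N)
  (hG : forall l k, G l k =
    cofactor_fun (f k) (x ord0) (x (c l)) (n k ord0) (n k (c l)))
  (g : nat) (Q : 'rV[R[i]]_N.+1) (eps : R)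
  (alpha beta : 'I_g -> R -> 'rV[R[i]]_N.+1)
  (gamma sigma0 : 'I_s -> R -> 'rV[R[i]]_N.+1) (tau : 'I_s -> R)
  (hpaths : path_data (C ord0) P Q eps alpha beta gamma sigma0 tau)
  (havoid : forall l,
    avoids_zeros_and_poles X (C ord0) (G l k1) (gamma l) /\
    avoids_zeros_and_poles X (C ord0) (G l k3) (gamma l)) :
  forall l : 'I_s,
    let m := fun k => n k ord0 in
    let nl := fun k => n k (c l) in
    refined_symbol X m nl (G l) (P l) =
    cexp ((2 * ipi R) ^- 2
          * log_refined_symbol X (C ord0) m nl (G l) (gamma l))
    * restricted_val X (C ord0) (G l k1) Q ^ (m k2 * nl k3)
    * restricted_val X (C ord0) (G l k3) Q ^ (- (m k2 * nl k1)).
Proof.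
move=> l m nl.
have vX := sd_variety hX.
have divC i : prime_divisor X (C i) by have [] := (sd_components hX (C i)).1 (ex_intro _ i erefl).
have vC i : variety (C i) by case: (divC i).
have CX i : C i `<=` X by case: (divC i).
have [c0 CP CcP] := sd_P_in hX l.
have [lx0 lxc] := sd_x_local hX l.
(* As [c l] is not 0, [x_0] has order 0 along [C_(c l)], and likewise [x_(c l)] along [C_0]. *)
have nx0 : nzratfun X (x ord0).
  apply: (ord0_nonzero vX (divC (c l))).
  by have := sd_x hX ord0 (c l); rewrite eq_sym (negbTE c0).
have nxc : nzratfun X (x (c l)).
  apply: (ord0_nonzero vX (divC ord0)).
  by have := sd_x hX (c l) ord0; rewrite (negbTE c0).
have uG k : unit_at X (P l) (G l k).
  rewrite hG; apply: (cofactor_unit (C := C) (i := ord0) (j := c l) vX) => //.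
  - exact: CX CP.
  - exact: sd_ratfun hX k.
  - exact: sd_divisor hX k.
  - by rewrite eq_sym.
  - by move=> i; case: (vC i).
  (* A third component through [P_l] would meet both [C_0] and [C_(c l)] there. *)
  - move=> i i0 ic CiP; have := sd_only_two hX CiP CP CcP.
    by case=> e; move: i0 ic c0; rewrite e eqxx.
have rG k : ratfun X (G l k).
  rewrite hG; apply: (ratfunM vX (sd_ratfun hX k)).
  have [//] := nzratfunV (nzratfunM vX (nzratfun_pow vX (n k ord0) nx0)
    (nzratfun_pow vX (n k (c l)) nxc)).
have [gQ gP] := pd_gamma hpaths l.
have [av1 av3] := havoid l.
have SC : punctured (C ord0) P `<=` C ord0 by move=> v [].
have I1 := cexp_path_integral_dlog vX (vC ord0) (CX ord0) SC (rG k1) CP (uG k1)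
  gQ gP av1.
have I3 := cexp_path_integral_dlog vX (vC ord0) (CX ord0) SC (rG k3) CP (uG k3)
  gQ gP av3.
(* Both values at [P_l] become the exponential of a path integral times the value at [Q]. *)
rewrite /refined_symbol -I1 -I3 /log_refined_symbol.
have ipi0 : 2 * ipi R != 0.
  rewrite mulf_neq0 ?pnatr_eq0//.
  by apply/eqP => -[] /eqP; rewrite gt_eqF// pi_gt0.
rewrite mulKf ?expf_neq0//.
exact: signed_powers_cexp.
Qed.
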